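(* Let $1\le p<\infty$ and let $E,F$ be Banach spaces such that $E^*$ and $F^*$ are smooth. Then $T:\mathrm{FBL}^{(p)}[E]\to\mathrm{FBL}^{(p)}[F]$ is a surjective lattice isometry if and only if $T=\overline U$ for some surjective linear isometry $U:E\to F$. Consequently, $E$ and $F$ are isometric if and only if $\mathrm{FBL}^{(p)}[E]$ is lattice isometric to $\mathrm{FBL}^{(p)}[F]$.
   Context: Banach spaces are real. A Banach space $Z$ is smooth if for every $z$ in its unit sphere there is a unique $f_z\in Z^*$ with $f_z(z)=\|f_z\|=1$. $H[E]$ is the vector lattice (pointwise operations) of positively homogeneous functions $f:E^*\to\mathbb R$, with $\|f\|_{\mathrm{FBL}^{(p)}[E]}=\sup\{(\sum_{k=1}^n|f(x_k^* )|^p)^{1/p}: n\in\mathbb N,\ x_1^*,\dots,x_n^*\in E^*,\ \sup_{x\in B_E}\sum_{k=1}^n|x_k^*(x)|^p\le 1\}$. For $x\in E$ let $\delta_x(x^* )=x^*(x)$. $\mathrm{FBL}^{(p)}[E]$ is the closure, in the space of $f\in H[E]$ with finite norm, of the sublattice generated by $\{\delta_x:x\in E\}$; $\phi_E(x)=\delta_x$ is a linear isometric embedding $E\to\mathrm{FBL}^{(p)}[E]$. For a bounded linear $U:E\to F$, $\overline U:\mathrm{FBL}^{(p)}[E]\to\mathrm{FBL}^{(p)}[F]$ is the unique lattice homomorphism with $\overline U\phi_E=\phi_FU$. A lattice isometry is a lattice homomorphism that is an isometry. *)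

(* Defs.v *)
From HB Require Import structures.
From mathcomp Require Import all_boot all_order all_algebra.
From mathcomp Require Import all_classical all_reals all_analysis.
From mathcomp Require Import lra ring.

Set Implicit Arguments.
Unset Strict Implicit.
Unset Printing Implicit Defensive.
Import Order.TTheory GRing.Theory Num.Theory numFieldNormedType.Exports.
Local Open Scope classical_set_scope.
Local Open Scope ring_scope.

Section Dual.
Context {R : realType} (E : normedModType R).
Implicit Types f g : E -> R.

Definition dual_pred : {pred E -> R} :=
  mem [set f : E -> R | linear f /\ continuous f].

Record dual := Dual { dual_val :> E -> R; dual_valP : dual_val \in dual_pred }.

HB.instance Definition _ := [isSub for dual_val].
HB.instance Definition _ := [Choice of dual by <:].

Lemma dual_pred_submod_closed : submod_closed dual_pred.
Proof.
split.
  rewrite inE; split => [a x y|x]; last exact: cvg_cst.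
  by rewrite -[RHS]/(a *: 0 + 0) scaler0 addr0.
move=> a f g; rewrite !inE => -[lf cf] [lg cg]; split => [b x y|x].
  rewrite -[LHS]/(a * f (b *: x + y) + g (b *: x + y)) lf lg.
  rewrite -[RHS]/(b * (a * f x + g x) + (a * f y + g y)) /GRing.scale/=; ring.
by apply: cvgD; [apply: cvgZr; exact: cf|exact: cg].
Qed.

HB.instance Definition _ :=
  GRing.isSubmodClosed.Build R (E -> R) dual_pred dual_pred_submod_closed.
HB.instance Definition _ := [SubChoice_isSubLmodule of dual by <:].

Lemma dual_linear (f : dual) : linear f.
Proof. by have := dual_valP f; rewrite inE => -[]. Qed.

Lemma dual_continuous (f : dual) : continuous f.
Proof. by have := dual_valP f; rewrite inE => -[]. Qed.

Lemma dualD (f g : dual) x : (f + g) x = f x + g x.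
Proof. by []. Qed.

Lemma dualZ (a : R) (f : dual) x : (a *: f) x = a * f x.
Proof. by []. Qed.

Lemma dualP (f g : dual) : f =1 g -> f = g.
Proof. by move=> fg; apply/val_inj/funext. Qed.

HB.instance Definition _ (f : dual) :=
  GRing.isLinear.Build R E R *:%R f (dual_linear f).

Definition dual_norm (f : dual) : R :=
  sup [set `|f x| | x in [set x : E | `|x| <= 1]].

Lemma dual_has_sup (f : dual) :
  has_sup [set `|f x| | x in [set x : E | `|x| <= 1]].
Proof.
split; first by exists `|f 0|, 0 => //=; rewrite normr0.
have /linear_bounded_continuous/linear_boundedP := @dual_continuous f.
move=> /pinfty_ex_gt0[M M0 fM]; exists M => _ [x /= x1 <-].
by rewrite (le_trans (fM x))// ler_piMr// ltW.
Qed.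

Lemma dual_norm_ub (f : dual) x : `|x| <= 1 -> `|f x| <= dual_norm f.
Proof.
by move=> x1; apply: ub_le_sup; [exact: (dual_has_sup f).2|exists x].
Qed.

Lemma dual_norm_lub (f : dual) M :
  (forall x, `|x| <= 1 -> `|f x| <= M) -> dual_norm f <= M.
Proof.
move=> fM; apply: ge_sup; first exact: (dual_has_sup f).1.
by move=> _ [x /= x1 <-]; exact: fM.
Qed.

Lemma dual_norm_ge0 (f : dual) : 0 <= dual_norm f.
Proof. by rewrite (le_trans _ (@dual_norm_ub f 0 _))// normr0. Qed.

Lemma dual_norm_bound (f : dual) x : `|f x| <= dual_norm f * `|x|.
Proof.
have [->|x0] := eqVneq x 0; first by rewrite linear0 !normr0 mulr0.
have nx : 0 < `|x| by rewrite normr_gt0.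
rewrite -ler_pdivrMr//.
have := @dual_norm_ub f (`|x|^-1 *: x); rewrite normrZ normfV normr_id.
rewrite mulVf ?gt_eqF// => /(_ (lexx _)).
by rewrite linearZ/= normrM normfV normr_id mulrC.
Qed.

Lemma dual_normD (f g : dual) : dual_norm (f + g) <= dual_norm f + dual_norm g.
Proof.
apply: dual_norm_lub => x x1; rewrite dualD.
by rewrite (le_trans (ler_normD _ _))// lerD// dual_norm_ub.
Qed.

Lemma dual_normZ (a : R) (f : dual) : dual_norm (a *: f) = `|a| * dual_norm f.
Proof.
have le b (h : dual) : dual_norm (b *: h) <= `|b| * dual_norm h.
  apply: dual_norm_lub => x x1.
  by rewrite dualZ normrM ler_wpM2l// dual_norm_ub.
apply/eqP; rewrite eq_le le/=.
have [->|a0] := eqVneq a 0; first by rewrite normr0 mul0r dual_norm_ge0.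
have := le a^-1 (a *: f); rewrite scalerA mulVf// scale1r normfV.
by rewrite ler_pdivlMl// normr_gt0.
Qed.

Lemma dual_norm_eq0 (f : dual) : dual_norm f = 0 -> f = 0.
Proof.
move=> f0; apply: dualP => x; apply/eqP; rewrite -normr_le0.
by rewrite (le_trans (dual_norm_bound f x))// f0 mul0r.
Qed.

HB.instance Definition _ :=
  Lmodule_isNormed.Build R dual dual_normD dual_normZ dual_norm_eq0.

End Dual.

Definition smooth (R : realType) (Z : normedModType R) : Prop :=
  forall z : Z, `|z| = 1 -> exists! f : dual Z, f z = 1 /\ `|f| = 1.

Section LpSum.
Context {R : realType} (p : R).

Definition lp_sum n (t : 'I_n -> R) : R := (\sum_(k < n) `|t k| `^ p) `^ p^-1.

Hypothesis p1 : 1 <= p.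
Let p0 : 0 < p. Proof. exact: lt_le_trans p1. Qed.
Let pn0 : p != 0. Proof. by rewrite gt_eqF. Qed.

Lemma lp_sum_ge0 n (t : 'I_n -> R) : 0 <= lp_sum t.
Proof. exact: powR_ge0. Qed.

Let sum_ge0 n (t : 'I_n -> R) : 0 <= \sum_(k < n) `|t k| `^ p.
Proof. by apply: sumr_ge0 => k _; exact: powR_ge0. Qed.

Lemma lp_sum_le n (t : 'I_n -> R) a : 0 <= a ->
  (lp_sum t <= a) = (\sum_(k < n) `|t k| `^ p <= a `^ p).
Proof.
move=> a0; apply/idP/idP => [ta|ta].
  have -> : \sum_(k < n) `|t k| `^ p = lp_sum t `^ p.
    by rewrite /lp_sum -powRrM mulVf// powRr1.
  by rewrite ge0_ler_powR// ?nnegrE ?lp_sum_ge0// ltW.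
have -> : a = (a `^ p) `^ p^-1 by rewrite -powRrM mulfV// powRr1.
by rewrite ge0_ler_powR// ?nnegrE ?powR_ge0// ?invr_ge0 ltW.
Qed.

Lemma lp_sum_mono n (s t : 'I_n -> R) :
  (forall k, `|s k| <= `|t k|) -> lp_sum s <= lp_sum t.
Proof.
move=> st; rewrite lp_sum_le ?lp_sum_ge0//.
rewrite (le_trans (_ : _ <= \sum_(k < n) `|t k| `^ p))//.
  by apply: ler_sum => k _; rewrite ge0_ler_powR// ?nnegrE// ltW.
by rewrite -lp_sum_le ?lp_sum_ge0.
Qed.

Lemma lp_sumZ n a (t : 'I_n -> R) :
  lp_sum (fun k => a * t k) = `|a| * lp_sum t.
Proof.
rewrite /lp_sum; under eq_bigr do rewrite normrM powRM//.
rewrite -mulr_sumr powRM ?powR_ge0//; congr (_ * _).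
by rewrite -powRrM mulfV// powRr1.
Qed.

Let powR_convex (l x y : R) : 0 <= l <= 1 -> 0 <= x -> 0 <= y ->
  (l * x + (1 - l) * y) `^ p <= l * x `^ p + (1 - l) * y `^ p.
Proof.
move=> /andP[l0 l1] x0 y0.
have := @convex_powR R p p1 (Itv01 l0 l1) x y.
rewrite !inE/= !in_itv/= !andbT => /(_ x0 y0).
by rewrite !convRE/=; exact.
Qed.

Let minkowski_aux n (s t : 'I_n -> R) a b : 0 < a -> 0 < b ->
  lp_sum s <= a -> lp_sum t <= b -> lp_sum (fun k => s k + t k) <= a + b.
Proof.
move=> a0 b0; have ab0 : 0 < a + b by exact: addr_gt0.
have [a0' b0' ab0'] := And3 (ltW a0) (ltW b0) (ltW ab0).
move=> sa tb.
rewrite (lp_sum_le s a0') in sa; rewrite (lp_sum_le t b0') in tb.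
rewrite (lp_sum_le _ ab0').
pose l := a / (a + b).
have l01 : 0 <= l <= 1.
  by rewrite divr_ge0//= ler_pdivrMr// mul1r lerDl.
have le k : `|s k + t k| `^ p <=
    (a + b) `^ p * (l * (`|s k| `^ p / a `^ p) +
                    (1 - l) * (`|t k| `^ p / b `^ p)).
  have e : `|s k| + `|t k| =
      (a + b) * (l * (`|s k| / a) + (1 - l) * (`|t k| / b)).
    by rewrite /l; field; rewrite !gt_eqF.
  rewrite (le_trans (_ : _ <= (`|s k| + `|t k|) `^ p))//.
    by rewrite ge0_ler_powR ?nnegrE ?ler_normD ?addr_ge0// ltW.
  rewrite {}e powRM//; last first.
    by have /andP[l0 l1] := l01; rewrite addr_ge0// mulr_ge0 ?divr_ge0 ?subr_ge0.
  rewrite ler_wpM2l ?powR_ge0//.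
  have powRV c x : 0 <= c -> 0 <= x -> x `^ p / c `^ p = (x / c) `^ p.
    move=> c0 x0; rewrite powRM ?invr_ge0//; congr (_ * _).
    rewrite -(powR_inv1 (powR_ge0 c p)) -(powR_inv1 c0) -!powRrM.
    by rewrite (mulrC p).
  by rewrite !powRV// powR_convex// divr_ge0.
rewrite (le_trans (ler_sum _ (fun k _ => le k)))// -mulr_sumr.
rewrite -[leRHS]mulr1 ler_wpM2l ?powR_ge0// big_split/= -!mulr_sumr -!mulr_suml.
have /andP[l0 l1] := l01.
rewrite -[leRHS](subrK l 1) addrC lerD//.
  by rewrite ler_piMr ?subr_ge0// ler_pdivrMr ?powR_gt0// mul1r.
by rewrite ler_piMr// ler_pdivrMr ?powR_gt0// mul1r.
Qed.

Lemma lp_sumD n (s t : 'I_n -> R) :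
  lp_sum (fun k => s k + t k) <= lp_sum s + lp_sum t.
Proof.
apply/ler_addgt0Pr => e e0.
rewrite [e]splitr addrACA; apply: minkowski_aux;
  by rewrite ?lerDl ?ltr_wpDl ?lp_sum_ge0// ?ltW// divr_gt0.
Qed.

End LpSum.

Section FBLNorm.
Context {R : realType} (p : R) (E : normedModType R).
Implicit Types f g : dual E -> R.

Definition weakly_p_contractive n (xs : 'I_n -> dual E) : Prop :=
  (ereal_sup [set (\sum_(k < n) `|xs k x| `^ p)%:E | x in [set x : E | `|x| <= 1]%R]
     <= 1)%E.

(* n = 0 is harmless: it only contributes the value 0. *)
Definition fbl_norm f : \bar R :=
  ereal_sup [set r | exists n (xs : 'I_n -> dual E),
    weakly_p_contractive xs /\ r = (lp_sum p (f \o xs))%:E].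

Definition pos_homogeneous f : Prop :=
  forall (a : R) (u : dual E), 0 <= a -> f (a *: u) = a * f u.

Hypothesis p1 : 1 <= p.
Let p0 : 0 < p. Proof. exact: lt_le_trans p1. Qed.
Let pn0 : p != 0. Proof. by rewrite gt_eqF. Qed.

Lemma weakly_p_contractiveP n (xs : 'I_n -> dual E) :
  weakly_p_contractive xs <->
  forall x, `|x| <= 1 -> lp_sum p (fun k => xs k x) <= 1.
Proof.
split => [xs1 x x1|xs1].
  rewrite lp_sum_le// powR1 -lee_fin (le_trans _ xs1)//.
  by apply: ereal_sup_ubound; exists x.
apply: ge_ereal_sup => _ [x /= x1 <-].
by rewrite lee_fin; have := xs1 x x1; rewrite lp_sum_le// powR1.
Qed.

Lemma fbl_norm_leP f (M : R) : (fbl_norm f <= M%:E)%E <->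
  forall n (xs : 'I_n -> dual E), weakly_p_contractive xs ->
    lp_sum p (f \o xs) <= M.
Proof.
split=> [fM n xs xs1|fM].
  rewrite -lee_fin (le_trans _ fM)//.
  by apply: ereal_sup_ubound; exists n, xs.
by apply: ge_ereal_sup => _ [n [xs [xs1 ->]]]; rewrite lee_fin fM.
Qed.

Lemma fbl_norm_ge0 f : (0 <= fbl_norm f)%E.
Proof.
apply: (@le_trans _ _ (lp_sum p (f \o (fun k : 'I_0 => 0)))%:E).
  by rewrite lee_fin lp_sum_ge0.
apply: ereal_sup_ubound; exists 0%N, (fun=> 0); split => //.
apply/weakly_p_contractiveP => x _.
by rewrite lp_sum_le// big_ord0 powR_ge0.
Qed.

Definition finite_fbl_norm : {pred dual E -> R} :=
  mem [set f | pos_homogeneous f /\ (fbl_norm f < +oo)%E].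

Lemma finite_fbl_normP f : reflect
  (pos_homogeneous f /\ (fbl_norm f < +oo)%E) (f \in finite_fbl_norm).
Proof. by apply: (iffP idP); rewrite inE. Qed.

Lemma fbl_normE f : (fbl_norm f < +oo)%E -> fbl_norm f = (fine (fbl_norm f))%:E.
Proof. by move=> fy; rewrite fineK// ge0_fin_numE ?fbl_norm_ge0. Qed.

Lemma fine_fbl_norm_lub f (M : R) :
  (forall n (xs : 'I_n -> dual E), weakly_p_contractive xs ->
    lp_sum p (f \o xs) <= M) ->
  (fbl_norm f < +oo)%E /\ fine (fbl_norm f) <= M.
Proof.
move=> /fbl_norm_leP fM.
have fy : (fbl_norm f < +oo)%E by rewrite (le_lt_trans fM)// ltry.
by split => //; rewrite -lee_fin -fbl_normE.
Qed.

Lemma fine_fbl_norm_ub f n (xs : 'I_n -> dual E) : (fbl_norm f < +oo)%E ->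
  weakly_p_contractive xs -> lp_sum p (f \o xs) <= fine (fbl_norm f).
Proof. by move=> fy; move: n xs; apply/fbl_norm_leP; rewrite -fbl_normE. Qed.

Lemma fine_fbl_norm_mono f g : (fbl_norm g < +oo)%E ->
  (forall u, `|f u| <= `|g u|) ->
  (fbl_norm f < +oo)%E /\ fine (fbl_norm f) <= fine (fbl_norm g).
Proof.
move=> gy fg; apply: fine_fbl_norm_lub => n xs xs1.
apply: le_trans (fine_fbl_norm_ub gy xs1).
by apply: lp_sum_mono => // k; exact: fg.
Qed.

Lemma fine_fbl_normD f g : (fbl_norm f < +oo)%E -> (fbl_norm g < +oo)%E ->
  (fbl_norm (f + g)%R < +oo)%E /\
  fine (fbl_norm (f + g)) <= fine (fbl_norm f) + fine (fbl_norm g).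
Proof.
move=> fy gy; apply: fine_fbl_norm_lub => n xs xs1.
apply: le_trans (lp_sumD p1 (f \o xs) (g \o xs)) _.
by rewrite lerD// fine_fbl_norm_ub.
Qed.

Lemma fine_fbl_normZ (a : R) f : (fbl_norm f < +oo)%E ->
  (fbl_norm (a *: f)%R < +oo)%E /\
  fine (fbl_norm (a *: f)) = `|a| * fine (fbl_norm f).
Proof.
have le b g : (fbl_norm g < +oo)%E -> (fbl_norm (b *: g)%R < +oo)%E /\
    fine (fbl_norm (b *: g)) <= `|b| * fine (fbl_norm g).
  move=> gy; apply: fine_fbl_norm_lub => n xs xs1.
  by rewrite lp_sumZ// ler_wpM2l// fine_fbl_norm_ub.
move=> fy; have [afy af] := le a f fy; split=> //.
apply/eqP; rewrite eq_le af/=.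
have [->|a0] := eqVneq a 0.
  by rewrite normr0 mul0r fine_ge0// fbl_norm_ge0.
have [_] := le a^-1 _ afy; rewrite scalerA mulVf// scale1r normfV.
by rewrite ler_pdivlMl// normr_gt0.
Qed.

Lemma fbl_norm_eq0 f : pos_homogeneous f -> (fbl_norm f < +oo)%E ->
  fine (fbl_norm f) = 0 -> f = 0.
Proof.
move=> hf fy f0; apply/funext => u; apply/eqP; rewrite -normr_le0.
pose c := (`|u| + 1)^-1.
have c0 : 0 < c by rewrite invr_gt0 ltr_wpDl.
have xs1 : weakly_p_contractive (fun _ : 'I_1 => c *: u).
  apply/weakly_p_contractiveP => x x1.
  rewrite lp_sum_le// big_ord1; apply: ge0_ler_powR; rewrite ?nnegrE//.
    exact: ltW.
  rewrite -[(c *: u) x]/(c * u x) normrM gtr0_norm//.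
  rewrite /c ler_pdivrMl ?ltr_wpDl// mulr1.
  rewrite (le_trans (dual_norm_ub u x1))//.
  by rewrite -[dual_norm u]/`|u| lerDl.
have := fine_fbl_norm_ub fy xs1.
rewrite f0 lp_sum_le// big_ord1 powR0//= (hf _ _ (ltW c0)) => h.
have : `|c * f u| `^ p == 0 by rewrite eq_le h powR_ge0.
rewrite powR_eq0 pn0 andbT normr_eq0 mulf_eq0 gt_eqF//= => /eqP ->.
by rewrite normr0.
Qed.

End FBLNorm.
Section FiniteNorm.
Context {R : realType} (p : R) (p1 : 1 <= p) (E : normedModType R).

Let p0 : 0 < p. Proof. exact: lt_le_trans p1. Qed.

(* The elements of H[E] with finite FBL^(p)-norm. The proof p1 is a parameter
   because the norm axioms depend on it, as for LfunType in hoelder. *)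
Record homfun := HomFun {
  homfun_val :> dual E -> R;
  homfun_valP : homfun_val \in @finite_fbl_norm R p E }.

HB.instance Definition _ := [isSub for homfun_val].
HB.instance Definition _ := [Choice of homfun by <:].

Lemma finite_fbl_norm_submod_closed : submod_closed (@finite_fbl_norm R p E).
Proof.
split.
  apply/finite_fbl_normP; split => [a u _|]; first by rewrite -[RHS]/(a * 0) mulr0.
  apply: (@fine_fbl_norm_lub _ _ _ p1 _ 0 _).1 => n xs _.
  rewrite lp_sum_le// powR0 ?gt_eqF//.
  by rewrite big1// => k _; rewrite /= normr0 powR0// gt_eqF.
move=> a f g /finite_fbl_normP[hf fy] /finite_fbl_normP[hg gy].
apply/finite_fbl_normP; split.
  move=> b u b0; have -> : (a *: f + g) (b *: u) = a * f (b *: u) + g (b *: u) by [].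
  have -> : (a *: f + g) u = a * f u + g u by [].
  by rewrite (hf _ _ b0) (hg _ _ b0); ring.
have [afy _] := fine_fbl_normZ p1 a fy.
by have [] := fine_fbl_normD p1 afy gy.
Qed.

HB.instance Definition _ := GRing.isSubmodClosed.Build R (dual E -> R)
  (@finite_fbl_norm R p E) finite_fbl_norm_submod_closed.
HB.instance Definition _ := [SubChoice_isSubLmodule of homfun by <:].

Lemma ler_norm_join (a b : R) : `|Order.join a b| <= `| `|a| + `|b| |.
Proof.
rewrite [leRHS]ger0_norm ?addr_ge0//.
by have [ab|ab] := leP a b; rewrite ?lerDl ?lerDr.
Qed.

Lemma ler_norm_meet (a b : R) : `|Order.meet a b| <= `| `|a| + `|b| |.
Proof.
rewrite [leRHS]ger0_norm ?addr_ge0//.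
by have [ab|ab] := leP a b; rewrite ?lerDl ?lerDr.
Qed.

Lemma fine_fbl_norm_abs (f : dual E -> R) : (fbl_norm p f < +oo)%E ->
  (fbl_norm p (fun u => `|f u|)%R < +oo)%E /\
  fine (fbl_norm p (fun u => `|f u|)) <= fine (fbl_norm p f).
Proof.
by move=> fy; apply: fine_fbl_norm_mono => // u; rewrite normr_id.
Qed.

Lemma finite_fbl_norm_join_closed :
  {in @finite_fbl_norm R p E &, forall f g,
    (f `|` g)%O \in @finite_fbl_norm R p E}.
Proof.
move=> f g /finite_fbl_normP[hf fy] /finite_fbl_normP[hg gy].
apply/finite_fbl_normP; split.
  by move=> a u a0; rewrite !joinfE (hf _ _ a0) (hg _ _ a0) !joinEtotal maxr_pMr.
have [fy' _] := fine_fbl_norm_abs fy; have [gy' _] := fine_fbl_norm_abs gy.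
have [fgy _] := fine_fbl_normD p1 fy' gy'.
by apply: (fine_fbl_norm_mono p1 fgy _).1 => u; exact: ler_norm_join.
Qed.

Lemma finite_fbl_norm_meet_closed :
  {in @finite_fbl_norm R p E &, forall f g,
    (f `&` g)%O \in @finite_fbl_norm R p E}.
Proof.
move=> f g /finite_fbl_normP[hf fy] /finite_fbl_normP[hg gy].
apply/finite_fbl_normP; split.
  by move=> a u a0; rewrite !meetfE (hf _ _ a0) (hg _ _ a0) !meetEtotal minr_pMr.
have [fy' _] := fine_fbl_norm_abs fy; have [gy' _] := fine_fbl_norm_abs gy.
have [fgy _] := fine_fbl_normD p1 fy' gy'.
by apply: (fine_fbl_norm_mono p1 fgy _).1 => u; exact: ler_norm_meet.
Qed.

HB.instance Definition _ := Order.isLatticeClosed.Build FunOrder.fun_display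
  (dual E -> R) (@finite_fbl_norm R p E)
  finite_fbl_norm_meet_closed finite_fbl_norm_join_closed.
HB.instance Definition _ :=
  [SubChoice_isSubLattice of homfun by <: with FunOrder.fun_display].

Lemma homfun_fin (f : homfun) : (fbl_norm p f < +oo)%E.
Proof. by have /finite_fbl_normP[] := homfun_valP f. Qed.

Lemma homfun_hom (f : homfun) : pos_homogeneous f.
Proof. by have /finite_fbl_normP[] := homfun_valP f. Qed.

Definition homfun_norm (f : homfun) : R := fine (fbl_norm p f).

Lemma homfun_normD (f g : homfun) :
  homfun_norm (f + g) <= homfun_norm f + homfun_norm g.
Proof. exact: (fine_fbl_normD p1 (homfun_fin f) (homfun_fin g)).2. Qed.

Lemma homfun_normZ (a : R) (f : homfun) :
  homfun_norm (a *: f) = `|a| * homfun_norm f.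
Proof. exact: (fine_fbl_normZ p1 a (homfun_fin f)).2. Qed.

Lemma homfun_norm_eq0 (f : homfun) : homfun_norm f = 0 -> f = 0.
Proof.
move=> f0; apply/val_inj.
exact: (fbl_norm_eq0 p1 (@homfun_hom f) (homfun_fin f)).
Qed.

HB.instance Definition _ :=
  Lmodule_isNormed.Build R homfun homfun_normD homfun_normZ homfun_norm_eq0.

Lemma homfun_normE (f : homfun) : `|f| = fine (fbl_norm p f).
Proof. by []. Qed.

Lemma homfun_norm_mono (f g : homfun) :
  (forall u, `|f u| <= `|g u|) -> `|f| <= `|g|.
Proof. by move=> fg; exact: (fine_fbl_norm_mono p1 (homfun_fin g) fg).2. Qed.

Lemma delta_subproof (x : E) :
  (fun u : dual E => u x) \in @finite_fbl_norm R p E.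
Proof.
apply/finite_fbl_normP; split => //.
apply: (@fine_fbl_norm_lub _ _ _ p1 _ `|x| _).1 => n xs.
move=> /(weakly_p_contractiveP p1) xs1.
have [->|x0] := eqVneq x 0.
  rewrite normr0 lp_sum_le// powR0 ?gt_eqF// big1// => k _ /=.
  by rewrite linear0 normr0 powR0// gt_eqF.
have nx : 0 < `|x| by rewrite normr_gt0.
have -> : (fun u : dual E => u x) \o xs =
    (fun k => `|x| * xs k (`|x|^-1 *: x)).
  by apply/funext => k /=; rewrite linearZ/= mulrA mulfV ?mul1r// gt_eqF.
rewrite lp_sumZ// normr_id ler_piMr// xs1// normrZ normfV normr_id.
by rewrite mulVf// gt_eqF.
Qed.

Definition delta (x : E) : homfun := HomFun (delta_subproof x).

Lemma deltaE (x : E) (u : dual E) : delta x u = u x.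
Proof. by []. Qed.

Definition vector_sublattice (A : set homfun) : Prop :=
  [/\ A 0,
      forall (a : R) f g, A f -> A g -> A (a *: f + g),
      forall f g, A f -> A g -> A (f `|` g)%O
    & forall f g, A f -> A g -> A (f `&` g)%O].

(* smallest ... (range delta) is the sublattice generated by the delta x, and
   closure is taken in the normed topology of homfun. *)
Definition fbl_pred : {pred homfun} :=
  mem (closure (smallest vector_sublattice (range delta))).

Lemma homfun_closureP (A : set homfun) (f : homfun) :
  closure A f <-> forall e, 0 < e -> exists2 g, A g & `|f - g| < e.
Proof.
split=> [fA e e0|fA B /nbhs_ballP[e /= e0 feB]].
  have [g [Ag]] := fA _ (nbhsx_ballx f e e0).
  by rewrite -ball_normE /= => fg; exists g.
have [g Ag fg] := fA _ e0; exists g; split=> //.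
by apply: feB; rewrite -ball_normE.
Qed.

Lemma fbl_predP (f : homfun) : reflect
  (forall e, 0 < e -> exists2 g,
     smallest vector_sublattice (range delta) g & `|f - g| < e)
  (f \in fbl_pred).
Proof. by apply: (iffP idP); rewrite inE homfun_closureP. Qed.

Record fbl := Fbl { fbl_val :> homfun; fbl_valP : fbl_val \in fbl_pred }.

HB.instance Definition _ := [isSub for fbl_val].
HB.instance Definition _ := [Choice of fbl by <:].

Lemma smallest_vector_sublattice (A : set homfun) :
  vector_sublattice (smallest vector_sublattice A).
Proof.
split=> [|a f g fA gA|f g fA gA|f g fA gA] B BA; have [[B0 BD BU BI] _] := BA.
- exact: B0.
- exact: BD (fA B BA) (gA B BA).
- exact: BU (fA B BA) (gA B BA).
- exact: BI (fA B BA) (gA B BA).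
Qed.

Lemma ler_dist_join (a b c d : R) :
  `|Order.join a b - Order.join c d| <= `|a - c| + `|b - d|.
Proof.
rewrite !joinEtotal.
have ac := ler_norm (a - c); have bd := ler_norm (b - d).
have ca := ler_norm (c - a); have db := ler_norm (d - b).
rewrite (distrC c a) in ca; rewrite (distrC d b) in db.
have ac0 := normr_ge0 (a - c); have bd0 := normr_ge0 (b - d).
by rewrite ler_norml; case: (leP a b) => ?; case: (leP c d) => ?; lra.
Qed.

Lemma ler_dist_meet (a b c d : R) :
  `|Order.meet a b - Order.meet c d| <= `|a - c| + `|b - d|.
Proof.
rewrite !meetEtotal.
have ac := ler_norm (a - c); have bd := ler_norm (b - d).
have ca := ler_norm (c - a); have db := ler_norm (d - b).
rewrite (distrC c a) in ca; rewrite (distrC d b) in db.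
have ac0 := normr_ge0 (a - c); have bd0 := normr_ge0 (b - d).
by rewrite ler_norml; case: (leP a b) => ?; case: (leP c d) => ?; lra.
Qed.

Lemma homfun_norm_dom (h f g : homfun) :
  (forall u, `|h u| <= `|f u| + `|g u|) -> `|h| <= `|f| + `|g|.
Proof.
move=> hfg; apply: (fine_fbl_norm_lub p1 _).2 => n xs xs1.
apply: le_trans (lerD (fine_fbl_norm_ub p1 (homfun_fin f) xs1)
                      (fine_fbl_norm_ub p1 (homfun_fin g) xs1)).
pose F k := `|f (xs k)|; pose G k := `|g (xs k)|.
have hFG : lp_sum p (h \o xs) <= lp_sum p (fun k => F k + G k).
  apply: lp_sum_mono => // k; rewrite [leRHS]ger0_norm; first exact: hfg.
  exact: addr_ge0 (normr_ge0 _) (normr_ge0 _).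
apply: le_trans hFG _; apply: le_trans (lp_sumD p1 F G) _.
by apply: lerD; apply: lp_sum_mono => // k; rewrite normr_id.
Qed.

Lemma fbl_pred_submod_closed : submod_closed fbl_pred.
Proof.
have [S0 SD _ _] := smallest_vector_sublattice (range delta).
split; first by apply/fbl_predP => e e0; exists 0; rewrite ?subrr ?normr0.
move=> a f g /fbl_predP fS /fbl_predP gS; apply/fbl_predP => e e0.
have a0 : 0 < `|a| + 1 by rewrite ltr_wpDl.
have [f' Sf' ff'] := fS (e / 2 / (`|a| + 1)) (divr_gt0 (divr_gt0 e0 (ltr0Sn R 1)) a0).
have [g' Sg' gg'] := gS (e / 2) (divr_gt0 e0 (ltr0Sn R 1)).
exists (a *: f' + g'); first exact: SD.
have af : `|a *: (f - f')| <= e / 2.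
  rewrite normrZ; apply: (@le_trans _ _ ((`|a| + 1) * `|f - f'|)).
    by apply: ler_wpM2r => //; rewrite lerDl.
  by rewrite mulrC -ler_pdivlMr//; exact: ltW.
rewrite opprD addrACA -scalerBr.
apply: le_lt_trans (ler_normD _ _) _.
by apply: lt_le_trans (ler_ltD af gg') _; rewrite -splitr.
Qed.

Lemma fbl_pred_join_closed :
  {in fbl_pred &, forall f g, (f `|` g)%O \in fbl_pred}.
Proof.
have [_ _ SU _] := smallest_vector_sublattice (range delta).
move=> f g /fbl_predP fS /fbl_predP gS; apply/fbl_predP => e e0.
have [f' Sf' ff'] := fS (e / 2) (divr_gt0 e0 (ltr0Sn R 1)).
have [g' Sg' gg'] := gS (e / 2) (divr_gt0 e0 (ltr0Sn R 1)).
exists (f' `|` g')%O; first exact: SU.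
rewrite [e]splitr; apply: le_lt_trans (ltrD ff' gg').
by apply: homfun_norm_dom => u; exact: ler_dist_join.
Qed.

Lemma fbl_pred_meet_closed :
  {in fbl_pred &, forall f g, (f `&` g)%O \in fbl_pred}.
Proof.
have [_ _ _ SI] := smallest_vector_sublattice (range delta).
move=> f g /fbl_predP fS /fbl_predP gS; apply/fbl_predP => e e0.
have [f' Sf' ff'] := fS (e / 2) (divr_gt0 e0 (ltr0Sn R 1)).
have [g' Sg' gg'] := gS (e / 2) (divr_gt0 e0 (ltr0Sn R 1)).
exists (f' `&` g')%O; first exact: SI.
rewrite [e]splitr; apply: le_lt_trans (ltrD ff' gg').
by apply: homfun_norm_dom => u; exact: ler_dist_meet.
Qed.

HB.instance Definition _ := GRing.isSubmodClosed.Build R homfun fbl_pred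
  fbl_pred_submod_closed.
HB.instance Definition _ := [SubChoice_isSubLmodule of fbl by <:].
HB.instance Definition _ := Order.isLatticeClosed.Build FunOrder.fun_display
  homfun fbl_pred fbl_pred_meet_closed fbl_pred_join_closed.
HB.instance Definition _ :=
  [SubChoice_isSubLattice of fbl by <: with FunOrder.fun_display].

Lemma fbl_normD (f g : fbl) : `|val (f + g)| <= `|val f| + `|val g|.
Proof. exact: ler_normD. Qed.

Lemma fbl_normZ (a : R) (f : fbl) : `|val (a *: f)| = `|a| * `|val f|.
Proof. exact: normrZ. Qed.

Lemma fbl_norm0_eq0 (f : fbl) : `|val f| = 0 -> f = 0.
Proof. by move=> /normr0_eq0 f0; exact/val_inj. Qed.

HB.instance Definition _ :=
  Lmodule_isNormed.Build R fbl fbl_normD fbl_normZ fbl_norm0_eq0.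

Lemma fbl_normrE (f : fbl) : `|f| = fine (fbl_norm p (val f)).
Proof. by []. Qed.

Lemma fbl_joinE (f g : fbl) (u : dual E) :
  (f `|` g)%O u = Num.max (f u) (g u).
Proof. by rewrite -joinEtotal. Qed.

Lemma fbl_meetE (f g : fbl) (u : dual E) :
  (f `&` g)%O u = Num.min (f u) (g u).
Proof. by rewrite -meetEtotal. Qed.

Lemma fbl_linE (a : R) (f g : fbl) (u : dual E) :
  (a *: f + g) u = a * f u + g u.
Proof. by []. Qed.

Lemma phi_subproof (x : E) : delta x \in fbl_pred.
Proof.
apply/fbl_predP => e e0; exists (delta x); last by rewrite subrr normr0.
by apply: sub_gen_smallest; exists x.
Qed.

Definition phi (x : E) : fbl := Fbl (phi_subproof x).

Lemma phiE (x : E) (u : dual E) : phi x u = u x.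
Proof. by []. Qed.

End FiniteNorm.

Definition is_isometry (R : realType) (V W : normedModType R) (U : V -> W) : Prop :=
  forall x y, `|U x - U y| = `|x - y|.

Definition lattice_homomorphism (R : realType) (p : R) (p1 : 1 <= p)
    (E F : normedModType R) (T : fbl p1 E -> fbl p1 F) : Prop :=
  [/\ linear T, Order.meet_morphism T & Order.join_morphism T].

Definition lattice_isometry (R : realType) (p : R) (p1 : 1 <= p)
    (E F : normedModType R) (T : fbl p1 E -> fbl p1 F) : Prop :=
  lattice_homomorphism T /\ is_isometry T.

(* \overline{U} as a definite description: for bounded linear U between Banach
   spaces exactly one S satisfies the condition (this is not proved here), so the
   default value of get is irrelevant. *)
Definition ubar (R : realType) (p : R) (p1 : 1 <= p) (E F : normedModType R)
    (U : E -> F) : fbl p1 E -> fbl p1 F :=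
  get [set S : fbl p1 E -> fbl p1 F |
    lattice_homomorphism S /\ forall x, S (phi p1 x) = phi p1 (U x)].
Arguments ubar {R p} p1 {E F} U.

Definition isometric (R : realType) (V W : normedModType R) : Prop :=
  exists U : V -> W, [/\ linear U, is_isometry U & set_surj setT setT U].

Definition lattice_isometric (R : realType) (p : R) (p1 : 1 <= p)
    (E F : normedModType R) : Prop :=
  exists T : fbl p1 E -> fbl p1 F, lattice_isometry T /\ set_surj setT setT T.

(* Main.v *)
(* Let T be a surjective lattice isometry. Then T f = f o A for a positively
   homogeneous bijection A of F^* onto E^*, given by A u x = T (phi x) u, and A
   and its inverse preserve weakly p-contractive tuples. Fix x in the unit sphere
   of E and a norming functional w of x. Since E^* is smooth, x is the support
   functional of w; let g be that of c = A^-1 w. For tuples of length two,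
     sup (|w|^p + s |A a|^p) = 1 + s |A a x|^p + o(s),
     sup (|c|^p + s |a|^p)   = 1 + s |g a|^p   + o(s)    (s -> 0),
   so |T (phi x)| = |g| on F^*. Being continuous, T (phi x) is then +-g or +-|g|,
   and the last two are excluded because phi x and T (phi x) would have constant
   sign. So T (phi x) is linear on F^*. A linear element of FBL^(p)[F] nearly
   vanishes on the annihilator of finitely many points of F, so it is a norm limit
   of evaluations at points of F and equals some phi y by completeness. This gives
   U with T o phi = phi o U.

   A lattice homomorphism is determined by its values on phi E, without continuity
   assumptions, because every f is a relatively uniform limit of elements of the
   sublattice generated by phi E. *)
Require Import Defs.
From HB Require Import structures.
From mathcomp Require Import all_boot all_order all_algebra.
From mathcomp Require Import all_classical all_reals all_analysis.
From mathcomp Require Import lra ring.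
Set Implicit Arguments.
Unset Strict Implicit.
Unset Printing Implicit Defensive.
Import Order.TTheory GRing.Theory Num.Theory numFieldNormedType.Exports.
Local Open Scope classical_set_scope.
Local Open Scope ring_scope.

(** * A Hahn-Banach theorem *)

Section HahnBanach.
Context {R : realType} {V : lmodType R}.
Implicit Types q : V -> R.

Definition sublinear q : Prop :=
  (forall x y, q (x + y) <= q x + q y) /\
  (forall a x, 0 <= a -> q (a *: x) <= a * q x).

Lemma sublinear0 q : sublinear q -> q 0 = 0.
Proof.
move=> [qD qZ]; have := qZ 0 0 (lexx _); have := qD 0 0.
by rewrite scale0r addr0 mul0r => ? ?; lra.
Qed.

Lemma sublinear_ge q x : sublinear q -> - q (- x) <= q x.
Proof.
move=> qs; have := qs.1 x (- x); rewrite subrr sublinear0//.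
by move=> ?; lra.
Qed.

Lemma sublinearZ q (a : R) x : sublinear q -> 0 <= a -> q (a *: x) = a * q x.
Proof.
move=> qs; rewrite le_eqVlt => /predU1P[<-|a0].
  by rewrite scale0r mul0r sublinear0.
apply/eqP; rewrite eq_le qs.2 ?(ltW a0)//= -ler_pdivlMl//.
have := qs.2 a^-1 (a *: x); rewrite scalerA mulVf ?gt_eqF// scale1r.
by rewrite invr_ge0 (ltW a0) => ->.
Qed.

Lemma inf_le_exists (S : set R) (a e : R) : S !=set0 -> 0 < e ->
  inf S <= a -> exists2 s, S s & s < a + e.
Proof.
move=> S0 e0 Sa; apply: contrapT => h.
suff : a + e <= inf S by move=> ?; lra.
apply: lb_le_inf => // s Ss; rewrite leNgt; apply/negP => sa.
by apply: h; exists s.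
Qed.

(** The infimal convolution of [q] with the function sending - t z to - t q z on the ray through -
    z. *)
Definition sublinear_descent q (z : V) : V -> R :=
  fun x => inf [set q (x + t *: z) - t * q z | t in [set t : R | 0 <= t]].

Section descent.
Variables (q : V -> R) (z : V).
Hypothesis qs : sublinear q.
Local Notation D := (sublinear_descent q z).

Lemma sublinear_descent_lb x t : 0 <= t -> D x <= q (x + t *: z) - t * q z.
Proof.
move=> t0; apply: ge_inf; last by exists t.
(* A lower bound, as s q z = q (s z) <= q (x + s z) + q (- x). *)
exists (- q (- x)) => _ [s /= s0 <-].
have := qs.1 (x + s *: z) (- x).
by rewrite addrAC subrr add0r (sublinearZ z qs s0) => ?; lra.
Qed.

Lemma sublinear_descent_approx x e : 0 < e ->
  exists2 t, 0 <= t & q (x + t *: z) - t * q z < D x + e.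
Proof.
move=> e0; have [|_ [t /= t0 <-] te] := inf_le_exists _ e0 (lexx (D x)).
  by exists (q (x + 0 *: z) - 0 * q z), 0 => /=.
by exists t.
Qed.

Lemma sublinear_descent_le x : D x <= q x.
Proof.
by have := @sublinear_descent_lb x 0 (lexx _); rewrite scale0r addr0 mul0r subr0.
Qed.

Lemma sublinear_descentN : D (- z) <= - q z.
Proof.
have := @sublinear_descent_lb (- z) 1 ler01.
by rewrite scale1r addNr sublinear0// sub0r mul1r.
Qed.

(** Parameters t for x and s for y combine to t + s for x + y, and t for x becomes a t for a x. *)
Lemma sublinear_descent_sublinear : sublinear D.
Proof.
split => [x y|a x].
  apply/ler_addgt0Pr => e e0; have e20 : 0 < e / 2 by rewrite divr_gt0.
  have [t t0 tx] := sublinear_descent_approx x e20.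
  have [s s0 sy] := sublinear_descent_approx y e20.
  have := sublinear_descent_lb (x + y) (addr_ge0 t0 s0).
  have := qs.1 (x + t *: z) (y + s *: z).
  rewrite addrACA -scalerDl => ? ?; lra.
rewrite le_eqVlt => /predU1P[<-|a0].
  rewrite scale0r mul0r (le_trans (sublinear_descent_le _))// sublinear0//.
rewrite -ler_pdivrMl//; apply: lb_le_inf.
  by exists (q (x + 0 *: z) - 0 * q z), 0 => /=.
move=> _ [t /= t0 <-]; rewrite ler_pdivrMl// mulrBr -(sublinearZ _ qs (ltW a0)).
rewrite scalerDr scalerA mulrA; apply: sublinear_descent_lb.
by rewrite mulr_ge0// ltW.
Qed.

End descent.

(** Supplies the bounds of chains for Zorn's lemma. For subadditivity, the functionals nearly
    optimal at x and at y are comparable, and the smaller one serves both points. *)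
Lemma sublinear_chain_inf (q0 : V -> R) (A : set (V -> R)) (q1 : V -> R) :
  A q1 -> (forall q, A q -> sublinear q /\ forall x, q x <= q0 x) ->
  (forall q r, A q -> A r ->
     (forall x, q x <= r x) \/ (forall x, r x <= q x)) ->
  let m := fun x => inf [set q x | q in A] in
  sublinear m /\ forall q x, A q -> m x <= q x.
Proof.
move=> Aq1 Aq0 Atot m.
have mle q x : A q -> m x <= q x.
  move=> Aq; apply: ge_inf; last by exists q.
  (* A lower bound, as r x >= - r (- x) >= - q0 (- x). *)
  exists (- q0 (- x)) => _ [r Ar <-].
  have [rs rq0] := Aq0 r Ar; have := sublinear_ge x rs; have := rq0 (- x).
  by move=> ? ?; lra.
have mapprox x e : 0 < e -> exists2 q, A q & q x < m x + e.
  move=> e0; have [|_ [q Aq <-] qe] := inf_le_exists _ e0 (lexx (m x)).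
    by exists (q1 x), q1.
  by exists q.
split=> //; split => [x y|a x a0].
  apply/ler_addgt0Pr => e e0; have e20 : 0 < e / 2 by rewrite divr_gt0.
  have [q Aq qx] := mapprox x _ e20.
  have [r Ar ry] := mapprox y _ e20.
  have [qr|rq] := Atot _ _ Aq Ar.
    have := (Aq0 _ Aq).1.1 x y; have := mle _ (x + y) Aq; have := qr y.
    by move=> ? ? ?; lra.
  have := (Aq0 _ Ar).1.1 x y; have := mle _ (x + y) Ar; have := rq x.
  by move=> ? ? ?; lra.
move: a0; rewrite le_eqVlt => /predU1P[<-|a0].
  rewrite scale0r mul0r (le_trans (mle _ _ Aq1))// sublinear0//.
  exact: (Aq0 _ Aq1).1.
rewrite -ler_pdivrMl//; apply: lb_le_inf; first by exists (q1 x), q1.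
move=> _ [q Aq <-]; rewrite ler_pdivrMl// -(sublinearZ _ (Aq0 _ Aq).1 (ltW a0)).
exact: mle.
Qed.

(* A sublinear functional that is minimal for the pointwise order is odd, since
   its descent along z is sublinear, smaller, and at most - q z at - z. *)
Lemma sublinear_minorant (q0 : V -> R) : sublinear q0 ->
  exists2 f : V -> R, linear f & forall x, f x <= q0 x.
Proof.
move=> q0s.
pose P q := sublinear q /\ forall x, q x <= q0 x; pose T := {q | P q}.
(* The order is reversed, so that Zorn's lemma yields a pointwise minimal functional. *)
pose le (s t : T) := `[< forall x, sval t x <= sval s x >].
have [|r s t /asboolP rs /asboolP st|s t /asboolP st /asboolP ts|A Atot|m mmin] :=
  @Zorn T le.
- by move=> t; apply/asboolP => x.
- by apply/asboolP => x; exact: le_trans (st x) (rs x).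
- apply: eq_sig_hprop => [r|]; first exact: Prop_irrelevance.
  apply/funext => x; apply/eqP.
  by rewrite eq_le ts st.
- have [[t At]|A0] := pselect (exists t, A t); last first.
    exists (exist P q0 (conj q0s (fun x => lexx _))) => s As.
    by exfalso; apply: A0; exists s.
  have [|q [s As <-]|_ _ [s As <-] [s' As' <-]|ms mle] :=
    @sublinear_chain_inf q0 [set sval s | s in A] (sval t).
  + by exists t.
  + exact: (svalP s).
  + by have [/asboolP h|/asboolP h] := Atot _ _ As As'; [right|left].
  + have mq0 x : inf [set q x | q in [set sval s | s in A]] <= q0 x.
      by apply: le_trans ((svalP t).2 x); apply: mle; exists t.
    exists (exist P _ (conj ms mq0)) => s As; apply/asboolP => x /=.
    by apply: mle; exists s.
have [ms mq0] := svalP m; set q := sval m in ms mq0.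
have qN z : q (- z) = - q z.
  apply/eqP; rewrite eq_le; apply/andP; split; last first.
    by have := sublinear_ge (- z) ms; rewrite opprK.
  have Ds := sublinear_descent_sublinear z ms.
  have Dq0 x : sublinear_descent q z x <= q0 x.
    exact: le_trans (sublinear_descent_le z ms x) (mq0 x).
  have /(congr1 sval)/= qE : exist P _ (conj Ds Dq0) = m.
    by apply: mmin; apply/asboolP => x; exact: sublinear_descent_le.
  by rewrite -[leLHS]/(sval m (- z)) -qE; exact: sublinear_descentN.
have qD x y : q (x + y) = q x + q y.
  apply/eqP; rewrite eq_le ms.1/=.
  by have := ms.1 (- x) (- y); rewrite -opprD !qN => ?; lra.
exists q => // a x y; rewrite qD; congr (_ + _).
have [a0|a0] := leP 0 a; first by rewrite sublinearZ.
rewrite -[a]opprK scaleNr qN sublinearZ ?oppr_ge0 ?ltW//.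
by rewrite -[RHS]/(- - a * q x) mulNr.
Qed.

End HahnBanach.

(** * Bounded and norming functionals *)

Lemma linear_fctP (R : realType) (V : lmodType R) (g : V -> R) : linear g ->
  [/\ g 0 = 0, forall a b, g (a + b) = g a + g b,
      forall a b, g (a - b) = g a - g b & forall k a, g (k *: a) = k * g a].
Proof.
move=> lg.
pose G : {linear V -> R} := HB.pack g (GRing.isLinear.Build R V R *:%R g lg).
split; [exact: (linear0 G)|exact: (linearD G)|exact: (linearB G)|].
by move=> k a; rewrite -[LHS]/(G (k *: a)) linearZ.
Qed.

Lemma dualB (R : realType) (E : normedModType R) (u v : dual E) x :
  (u - v) x = u x - v x.
Proof. by []. Qed.

Lemma bounded_dual (R : realType) (E : normedModType R) (f : E -> R) (M : R) :
  linear f -> (forall x, `|f x| <= M * `|x|) -> f \in @dual_pred R E.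
Proof.
move=> lf fM; rewrite inE; split=> //.
pose g : {linear E -> R} := HB.pack f (GRing.isLinear.Build R E R *:%R f lf).
apply: (@bounded_linear_continuous R E R g); apply/linear_boundedP.
exists M; split=> [|r Mr x]; first exact: num_real.
by rewrite (le_trans (fM x))// ler_wpM2r// ltW.
Qed.

(** A linear minorant f of the norm lowered along x stays below the norm and has f (- x) <= - |x|.
    The norm is only bounded by 1, since E may be trivial. *)
Lemma norming_functional (R : realType) (E : normedModType R) (x : E) :
  exists2 u : dual E, `|u| <= 1 & u x = `|x|.
Proof.
have ns : sublinear (fun y : E => `|y|).
  by split=> [y z|a y a0]; [exact: ler_normD|rewrite normrZ ger0_norm].
have [f lf fle] := sublinear_minorant (sublinear_descent_sublinear x ns).
have fD y z : f (y + z) = f y + f z by have := lf 1 y z; rewrite !scale1r.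
have f0 : f 0 = 0 by have := fD 0 0; rewrite addr0 => ?; lra.
have fN y : f (- y) = - f y by have := fD y (- y); rewrite subrr f0 => ?; lra.
have fn y : `|f y| <= `|y|.
  have le z : f z <= `|z| := le_trans (fle z) (sublinear_descent_le _ ns z).
  by rewrite ler_norml le andbT lerNl -fN (le_trans (le _))// normrN.
have f1 y : `|f y| <= 1 * `|y| by rewrite mul1r.
have fP := bounded_dual lf f1.
exists (Dual fP).
  by apply: dual_norm_lub => y y1; exact: le_trans (fn y) y1.
apply/eqP; rewrite eq_le (le_trans (ler_norm _) (fn x))/= -lerN2 -fN.
exact: le_trans (fle _) (sublinear_descentN x ns).
Qed.

(** * Smoothness and support functionals *)

Lemma dual_eval_le (R : realType) (E : normedModType R) (u : dual E) x :
  `|x| <= 1 -> `|u x| <= `|u|.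
Proof. exact: dual_norm_ub. Qed.

Lemma dual_almost_norming (R : realType) (E : normedModType R) (u : dual E)
    (e : R) : 0 < e -> exists2 x, `|x| <= 1 & `|u| - e < u x.
Proof.
move=> e0; have [_ [x /= x1 <-] xe] := sup_adherent e0 (dual_has_sup u).
have [ux|ux] := leP 0 (u x).
  by exists x => //; rewrite ger0_norm in xe.
by exists (- x); rewrite ?normrN// linearN; rewrite ltr0_norm in xe.
Qed.

(** The interval [-M, M] is compact, and a cluster point of an ultrafilter is a limit. *)
Lemma ultra_bounded_cvg (R : realType) (T : Type) (U : set_system T)
    (b : T -> R) (M : R) : UltraFilter U -> U [set z | `|b z| <= M] ->
  exists l : R, b z @[z --> U] --> l.
Proof.
move=> UU bM.
have [l [_ bl]] : `[- M, M]%classic `&` cluster (b z @[z --> U]) !=set0.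
  have bI : U (b @^-1` `[- M, M]%classic).
    by apply: filterS bM => z bz; rewrite /= in_itv/= -ler_norml.
  exact: segment_compact bI.
exists l => N Nl; have [//|UN] := in_ultra_setVsetC (b @^-1` N) UU.
by have [r [nr Nr]] := bl (~` N) N UN Nl; have := nr Nr.
Qed.

(* Limits along an ultrafilter of points z of the unit ball with c z -> 1 are
   norm one functionals supporting c, so smoothness at c leaves only f. *)
Lemma smooth_support_limit (R : realType) (F : normedModType R) (c : dual F)
    (f : dual (dual F)) :
  `|c| = 1 -> (forall g : dual (dual F), g c = 1 -> `|g| = 1 -> g = f) ->
  forall (a : dual F) (e : R), 0 < e -> exists2 d : R, 0 < d &
    forall z, `|z| <= 1 -> 1 - d < c z -> `|a z - f a| < e.
Proof.
move=> c1 cf a e e0; apply: contrapT => nex.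
(* If no d works, every [B d] is inhabited and these sets form a filter base. *)
pose B (d : R) := [set z : F | [/\ `|z| <= 1, 1 - d < c z & e <= `|a z - f a|]].
have Bn d : 0 < d -> B d !=set0.
  move=> d0; apply: contrapT => Bd; apply: nex; exists d => // z z1 cz.
  by rewrite ltNge; apply/negP => az; apply: Bd; exists z.
have PF : ProperFilter (filter_from [set d | 0 < d] B).
  apply: filter_from_proper => //; apply: filter_from_filter.
    by exists 1 => /=.
  move=> d d' /= d0 d0'; exists (Num.min d d'); first by rewrite /= lt_min d0.
  have m1 : Num.min d d' <= d by rewrite ge_min lexx.
  have m2 : Num.min d d' <= d' by rewrite ge_min lexx orbT.
  by move=> z [z1 cz az]; split; split => //; lra.
have [U [UU BU]] := ultraFilterLemma PF.
have UB d : 0 < d -> U (B d) by move=> d0; apply: BU; exists d.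
have blim (b : dual F) : {l : R | b z @[z --> U] --> l}.
  apply: cid; apply: (@ultra_bounded_cvg _ _ _ _ `|b|).
  by apply: filterS (UB 1 ltr01) => z [z1 _ _]; exact: dual_eval_le.
pose g b := sval (blim b).
have gP (b : dual F) : b z @[z --> U] --> g b := svalP (blim b).
have lg : linear g.
  move=> k b b'; apply: (@cvg_unique _ _ (k * b z + b' z @[z --> U])) => //.
  - exact: (gP (k *: b + b')).
  - by apply: cvgD; [apply: cvgMr; exact: gP|exact: gP].
have gn b : `|g b| <= 1 * `|b|.
  rewrite mul1r.
  apply: (@closed_cvg _ _ U _ (fun z => `|b z|) (fun r => r <= `|b|)).
  - exact: closed_le.
  - by apply: filterS (UB 1 ltr01) => z [z1 _ _]; exact: dual_eval_le.
  - by apply: cvg_norm; exact: gP.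
pose G : dual (dual F) := Dual (bounded_dual lg gn).
have Gc : G c = 1.
  apply/eqP; rewrite eq_le; apply/andP; split.
    by have := gn c; rewrite c1 mul1r; apply: le_trans; exact: ler_norm.
  apply/ler_addgt0Pl => d d0; rewrite -lerBlDl.
  apply: (@closed_cvg _ _ U _ c (fun r => 1 - d <= r)) (gP c).
    exact: closed_ge.
  by apply: filterS (UB d d0) => z [_ /ltW].
have Gf : G = f.
  apply: cf => //; apply/eqP; rewrite eq_le; apply/andP; split.
    by apply: dual_norm_lub => b b1; rewrite (le_trans (gn b))// mul1r.
  rewrite -Gc; have := @dual_eval_le _ _ G c; rewrite c1 => /(_ (lexx _)).
  by apply: le_trans; exact: ler_norm.
(* The distance to f a kept by all points of [B 1] survives in the limit, contradicting G = f. *)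
have : e <= `|g a - f a|.
  apply: (@closed_cvg _ _ U _ (fun z => `|a z - f a|) (fun r => e <= r)).
  - exact: closed_ge.
  - by apply: filterS (UB 1 ltr01) => z [].
  - by apply: cvg_norm; apply: cvgB; [exact: gP|exact: cvg_cst].
by rewrite -Gf -[g a]/(G a) subrr normr0 leNgt e0.
Qed.

(** * The lattice FBL^(p)[E] *)

Section Fbl.
Context {R : realType} {p : R} (p1 : 1 <= p).
Implicit Types E F : normedModType R.

Let p0 : 0 < p. Proof. exact: lt_le_trans p1. Qed.

Lemma fbl_ext E (f g : fbl p1 E) : (forall u, f u = g u) -> f = g.
Proof. by move=> fg; do 2 apply: val_inj; apply/funext. Qed.

(** The sublattice generated by phi E, in a form that allows induction; 0 is obtained as phi 0. *)
Inductive lattice_span E : fbl p1 E -> Prop :=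
| lattice_span_phi x : lattice_span (phi p1 x)
| lattice_span_lin a f g :
    lattice_span f -> lattice_span g -> lattice_span (a *: f + g)
| lattice_span_join f g :
    lattice_span f -> lattice_span g -> lattice_span (f `|` g)%O
| lattice_span_meet f g :
    lattice_span f -> lattice_span g -> lattice_span (f `&` g)%O.

Lemma fblB E (f g : fbl p1 E) u : (f - g) u = f u - g u.
Proof. by []. Qed.

Lemma fblN E (f : fbl p1 E) u : (- f) u = - f u.
Proof. by []. Qed.

Lemma phi_linear E : linear (phi p1 (E:=E)).
Proof. by move=> a x y; apply: fbl_ext => u; rewrite fbl_linE !phiE linearP. Qed.

(** The image of [lattice_span] is a vector sublattice containing every [delta x], hence contains
    the smallest one. *)
Lemma fbl_dense E (f : fbl p1 E) (e : R) : 0 < e ->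
  exists2 g, lattice_span g & `|f - g| < e.
Proof.
move=> e0; have [g Sg fge] := elimT (fbl_predP p1 (fbl_val f)) (fbl_valP f) e e0.
suff [h hS hg] : [set fbl_val h | h in @lattice_span E] g.
  by subst g; exists h; [exact: hS|exact: fge].
apply: Sg; split; last first.
  by move=> _ [x _ <-]; exists (phi p1 x); [exact: lattice_span_phi|].
split.
- exists (phi p1 0); first exact: lattice_span_phi.
  by apply: val_inj; apply/funext => u; exact: (linear0 u).
- move=> a _ _ [h hS <-] [k kS <-]; exists (a *: h + k); last by [].
  exact: lattice_span_lin.
- move=> _ _ [h hS <-] [k kS <-]; exists (h `|` k)%O; last by [].
  exact: lattice_span_join.
- move=> _ _ [h hS <-] [k kS <-]; exists (h `&` k)%O; last by [].
  exact: lattice_span_meet.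
Qed.

Lemma lp_sum1 (t : 'I_1 -> R) : lp_sum p t = `|t ord0|.
Proof.
by rewrite /lp_sum big_ord1 -powRrM mulfV ?gt_eqF// powRr1.
Qed.

Lemma weakly_p_contractive1 E (u : dual E) : `|u| <= 1 ->
  weakly_p_contractive p (fun _ : 'I_1 => u).
Proof.
move=> u1; apply/(weakly_p_contractiveP p1) => x x1; rewrite lp_sum1.
by rewrite (le_trans _ u1)// dual_eval_le.
Qed.

Lemma fbl_hom E (f : fbl p1 E) (a : R) u : 0 <= a -> f (a *: u) = a * f u.
Proof. exact: homfun_hom. Qed.

Lemma fbl_tuple_le E (f : fbl p1 E) n (us : 'I_n -> dual E) :
  weakly_p_contractive p us -> lp_sum p (f \o us) <= `|f|.
Proof. by apply: (fine_fbl_norm_ub p1); exact: homfun_fin. Qed.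

Lemma fbl_norm_lub E (f : fbl p1 E) M :
  (forall n (us : 'I_n -> dual E),
     weakly_p_contractive p us -> lp_sum p (f \o us) <= M) -> `|f| <= M.
Proof. by move=> fM; have [] := fine_fbl_norm_lub p1 fM. Qed.

(** The normalised functional u / |u| is a contractive tuple of length one. *)
Lemma fbl_eval_le E (f : fbl p1 E) u : `|f u| <= `|f| * `|u|.
Proof.
have [->|u0] := eqVneq u 0.
  by rewrite -[0](scale0r 0) fbl_hom// mul0r normr0 mulr_ge0.
have nu : 0 < `|u| by rewrite normr_gt0.
rewrite -ler_pdivrMr//.
have : lp_sum p (f \o (fun _ : 'I_1 => `|u|^-1 *: u)) <= `|f|.
  apply: fbl_tuple_le; apply: weakly_p_contractive1.
  by rewrite normrZ normfV normr_id mulVf ?gt_eqF.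
rewrite lp_sum1 /= fbl_hom ?invr_ge0// normrM normfV normr_id mulrC.
exact.
Qed.

Lemma norm_phi E (x : E) : `|phi p1 x| = `|x|.
Proof.
apply/eqP; rewrite eq_le; apply/andP; split.
  apply: fbl_norm_lub => n us /(weakly_p_contractiveP p1) us1.
  have [->|x0] := eqVneq x 0.
    rewrite normr0 lp_sum_le// powR0 ?gt_eqF// big1// => k _ /=.
    by rewrite linear0 normr0 powR0// gt_eqF.
  have nx : 0 < `|x| by rewrite normr_gt0.
  have -> : phi p1 x \o us = (fun k => `|x| * us k (`|x|^-1 *: x)).
    by apply/funext => k /=; rewrite linearZ/= mulrA mulfV ?mul1r// gt_eqF.
  rewrite lp_sumZ// normr_id ler_piMr// us1// normrZ normfV normr_id.
  by rewrite mulVf// gt_eqF.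
have [u u1 <-] := norming_functional x.
rewrite -[u x]/(phi p1 x u) (le_trans (ler_norm _))//.
by rewrite (le_trans (fbl_eval_le _ _))// ler_piMr.
Qed.

Lemma phi_inj E : injective (phi p1 (E:=E)).
Proof.
move=> x y xy; apply/eqP; rewrite -subr_eq0 -normr_eq0 -norm_phi.
have -> : x - y = -1 *: y + x by rewrite scaleN1r addrC.
by rewrite phi_linear xy scaleN1r addNr normr0.
Qed.

End Fbl.

(** * Maps between duals preserving weakly p-contractive tuples *)

(** Under this condition, composition with [Phi] does not increase FBL norms. *)
Definition preserves_contractive (R : realType) (p : R) (E F : normedModType R)
    (Phi : dual F -> dual E) : Prop :=
  forall n (us : 'I_n -> dual F),
    weakly_p_contractive p us -> weakly_p_contractive p (Phi \o us).

Section Pairs.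
Context {R : realType} {p : R} (p1 : 1 <= p).
Implicit Types E F : normedModType R.

Let p0 : 0 < p. Proof. exact: lt_le_trans p1. Qed.

Definition pair_fun T (u v : T) : 'I_2 -> T :=
  fun k => if k == ord0 then u else v.

Lemma weakly_p_contractive2P E (u v : dual E) :
  weakly_p_contractive p (pair_fun u v) <->
  forall x, `|x| <= 1 -> `|u x| `^ p + `|v x| `^ p <= 1.
Proof.
rewrite (weakly_p_contractiveP p1); split=> h x x1; have := h x x1;
  by rewrite lp_sum_le// powR1 big_ord_recl big_ord1.
Qed.

(** The uniqueness half of smoothness at [u], in the form taken by [smooth_support_limit]. *)
Definition supports E (u : dual E) (f : dual (dual E)) : Prop :=
  `|u| = 1 /\ forall g : dual (dual E), g u = 1 -> `|g| = 1 -> g = f.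

Lemma ler_powR_id (a : R) : 0 <= a -> a <= 1 -> a `^ p <= a.
Proof.
rewrite le_eqVlt => /predU1P[<- _|a0 a1]; first by rewrite powR0// gt_eqF.
rewrite -[leRHS](powRr1 (ltW a0)).
have a01 : 0 < a <= 1 by rewrite a0.
exact: (ger_powR a01 p1).
Qed.

(** Take s with s |a|^p <= d. Where |c z| <= 1 - d, the loss d in the first term pays for the
    second; elsewhere z or - z nearly norms c, so |a z| <= |f a| + e. *)
Lemma pair_upper F (c : dual F) (f : dual (dual F)) (a : dual F) (e : R) :
  supports c f -> 0 < e -> exists2 s : R, 0 < s & forall z, `|z| <= 1 ->
    `|c z| `^ p + s * `|a z| `^ p <= 1 + s * (`|f a| + e) `^ p.
Proof.
move=> [c1 cf] e0; have [d d0 dP] := smooth_support_limit c1 cf a e0.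
have A0 : 0 <= `|a| `^ p by exact: powR_ge0.
have s0 : 0 < d / (`|a| `^ p + 1) by rewrite divr_gt0// ltr_wpDl.
exists (d / (`|a| `^ p + 1)) => //; set s := d / _ in s0 *.
have sA : s * `|a| `^ p <= d.
  by rewrite /s mulrAC ler_pdivrMr ?ltr_wpDl// ler_wpM2l ?(ltW d0)// lerDl.
move=> z z1; have cz1 : `|c z| <= 1 by rewrite -c1; exact: dual_eval_le.
have az : `|a z| `^ p <= `|a| `^ p.
  by rewrite (ge0_ler_powR (ltW p0)) ?nnegrE// dual_eval_le.
have := ler_wpM2l (ltW s0) az => saz.
have near w : `|w| <= 1 -> 1 - d < c w -> `|a w| <= `|f a| + e.
  move=> w1 cw; have := dP w w1 cw; have := lerB_dist (a w) (f a).
  by move=> ? ?; lra.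
have [cz|cz] := leP `|c z| (1 - d).
  have := ler_powR_id (normr_ge0 _) cz1.
  have := powR_ge0 (`|f a| + e) p; have : 0 <= s * (`|f a| + e) `^ p.
    by rewrite mulr_ge0 ?powR_ge0// (ltW s0).
  by move=> ? ? ?; lra.
apply: lerD; first by rewrite (le_trans (ler_powR_id _ _)).
rewrite ler_pM2l// (ge0_ler_powR (ltW p0)) ?nnegrE ?addr_ge0 ?(ltW e0)//.
have [c0|c0] := leP 0 (c z); first by rewrite (ger0_norm c0) in cz; exact: near.
rewrite -(normrN (a z)) -linearN; apply: near; first by rewrite normrN.
by rewrite linearN/= -(ltr0_norm c0).
Qed.

(** If K < L < |f a|, a point z that nearly norms c has |a z| >= L. There s |a z|^p exceeds s K^p by
    at least k, while |c z|^p > 1 - k, which violates the bound. *)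
Lemma pair_lower F (c : dual F) (f : dual (dual F)) (a : dual F) (s K : R) :
  supports c f -> 0 < s -> 0 <= K ->
  (forall z, `|z| <= 1 -> `|c z| `^ p + s * `|a z| `^ p <= 1 + s * K `^ p) ->
  `|f a| <= K.
Proof.
move=> [c1 cf] s0 K0 ub; rewrite leNgt; apply/negP => Kf.
pose L := (K + `|f a|) / 2.
have KL : K < L by rewrite /L; lra.
have Lf : 0 < `|f a| - L by rewrite /L; lra.
have [d d0 dP] := smooth_support_limit c1 cf a Lf.
have KLp : K `^ p < L `^ p.
  by apply: gt0_ltr_powR => //; rewrite nnegrE (le_trans K0)// ltW.
pose k := s * (L `^ p - K `^ p).
have k0 : 0 < k by rewrite mulr_gt0// subr_gt0.
(* The p-th root of 1 - k, cut off at 0 since k may exceed 1. *)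
pose r := Num.max 0 (1 - k) `^ p^-1.
have m0 : 0 <= Num.max 0 (1 - k) by rewrite le_max lexx.
have rp : r `^ p = Num.max 0 (1 - k) by rewrite -powRrM mulVf ?gt_eqF// powRr1.
have r1 : r < 1.
  suff : r < 1 `^ p^-1 by rewrite powR1.
  apply: gt0_ltr_powR; rewrite ?nnegrE ?invr_gt0//.
  by rewrite gt_max ltr01/=; lra.
have e0 : 0 < Num.min d (1 - r) by rewrite lt_min d0 subr_gt0.
have [z z1] := dual_almost_norming c e0; rewrite c1 => cz.
have md : Num.min d (1 - r) <= d by rewrite ge_min lexx.
have mr : Num.min d (1 - r) <= 1 - r by rewrite ge_min lexx orbT.
have cr : r < c z by lra.
have := dP z z1 _; have /[swap]/[apply] : 1 - d < c z by lra.
have := lerB_dist (f a) (a z); rewrite (distrC (f a)) => faz azf.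
have Laz : L `^ p <= `|a z| `^ p.
  by rewrite (ge0_ler_powR (ltW p0)) ?nnegrE//; lra.
have ck : 1 - k < `|c z| `^ p.
  apply: (@le_lt_trans _ _ (r `^ p)); first by rewrite rp le_max lexx orbT.
  apply: gt0_ltr_powR; rewrite ?nnegrE ?powR_ge0//.
  exact: lt_le_trans cr (ler_norm _).
have := ub z z1; have := ler_wpM2l (ltW s0) Laz; rewrite /k in ck.
by move=> ? ?; lra.
Qed.

Section transfer.
Variables (E F : normedModType R) (Phi : dual F -> dual E).
Hypothesis Phi_contr : preserves_contractive p Phi.
Hypothesis PhiZ : forall (a : R) u, 0 <= a -> Phi (a *: u) = a *: Phi u.

(* The pair (c, s ^ (1 / p) a) is scaled to be contractive. *)
Lemma pair_transfer (c a : dual F) (s M : R) : 0 < s -> 0 < M ->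
  (forall z, `|z| <= 1 -> `|c z| `^ p + s * `|a z| `^ p <= M) ->
  forall x, `|x| <= 1 -> `|Phi c x| `^ p + s * `|Phi a x| `^ p <= M.
Proof.
move=> s0 M0 ub.
pose m := M^-1 `^ p^-1; pose t := s `^ p^-1.
have mp : m `^ p = M^-1 by rewrite -powRrM mulVf ?gt_eqF// powRr1// invr_ge0 ltW.
have tp : t `^ p = s by rewrite -powRrM mulVf ?gt_eqF// powRr1// ltW.
have m0 : 0 <= m by exact: powR_ge0.
have t0 : 0 <= t by exact: powR_ge0.
have scaled (G : normedModType R) (u v : dual G) x :
    `|(m *: u) x| `^ p + `|(m *: (t *: v)) x| `^ p =
    M^-1 * (`|u x| `^ p + s * `|v x| `^ p).
  rewrite !dualZ !normrM (ger0_norm m0) (ger0_norm t0) !powRM ?mulr_ge0//.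
  by rewrite mp tp mulrDr.
have : weakly_p_contractive p (Phi \o pair_fun (m *: c) (m *: (t *: a))).
  apply: Phi_contr; apply/weakly_p_contractive2P => z z1.
  by rewrite scaled ler_pdivrMl// mulr1 ub.
have -> : Phi \o pair_fun (m *: c) (m *: (t *: a)) =
    pair_fun (m *: Phi c) (m *: (t *: Phi a)).
  by apply/funext => k; rewrite /pair_fun/=; case: ifP => _; rewrite !PhiZ.
move=> /weakly_p_contractive2P h x /h.
by rewrite scaled ler_pdivrMl// mulr1.
Qed.

End transfer.

Lemma eval_bidual E (x : E) : exists f : dual (dual E),
  (forall u, f u = u x) /\ `|f| <= `|x|.
Proof.
have lf : linear (fun u : dual E => u x) by [].
have fb (u : dual E) : `|u x| <= `|x| * `|u|.
  by rewrite mulrC; exact: dual_norm_bound.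
exists (Dual (bounded_dual lf fb)); split=> //.
apply: dual_norm_lub => u u1 /=; apply: le_trans (fb u) _.
by rewrite ler_piMr.
Qed.

Lemma smooth_supports E (u : dual E) : smooth (dual E) -> `|u| = 1 ->
  exists f, [/\ supports u f, f u = 1 & `|f| = 1].
Proof.
move=> sm u1; have [f [[fu f1] fmin]] := sm u u1.
by exists f; split=> //; split=> // g gu g1; rewrite (fmin g).
Qed.

(* A point x of the unit sphere is the support functional of some w, and
   |Phi a x| is recovered from the pair (w, Phi a) as the coefficient of s in
   sup |w|^p + s |Phi a|^p when s -> 0. *)
Lemma abs_linear_at_point E F (Phi : dual F -> dual E) (Psi : dual E -> dual F) :
  smooth (dual E) -> smooth (dual F) ->
  preserves_contractive p Phi -> preserves_contractive p Psi ->
  (forall (a : R) u, 0 <= a -> Phi (a *: u) = a *: Phi u) ->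
  (forall (a : R) u, 0 <= a -> Psi (a *: u) = a *: Psi u) ->
  (forall u, `|Phi u| <= `|u|) -> (forall u, `|Psi u| <= `|u|) ->
  cancel Phi Psi -> cancel Psi Phi ->
  forall x : E, `|x| = 1 ->
  exists g : dual (dual F), forall a, `|Phi a x| = `|g a|.
Proof.
move=> smE smF PhiC PsiC PhiZ PsiZ Phin Psin PhiK PsiK x x1.
have [w w1 wx] := norming_functional x; rewrite x1 in wx.
have {}w1 : `|w| = 1.
  apply/eqP; rewrite eq_le w1/= -wx (le_trans (ler_norm _))//.
  by apply: dual_eval_le; rewrite x1.
have c1 : `|Psi w| = 1.
  by apply/eqP; rewrite eq_le -{1}w1 Psin/= -w1 -{1}(PsiK w) Phin.
have [f [fs _ _]] := smooth_supports smE w1.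
have [g [gs _ _]] := smooth_supports smF c1.
(* Evaluation at x is a norm one functional with value 1 at w, so it is the support functional of
   w. *)
have fE u : f u = u x.
  have [h [hE hn]] := eval_bidual x; rewrite -(fs.2 h) ?hE//.
  apply/eqP; rewrite eq_le -{1}x1 hn/= -wx -hE (le_trans (ler_norm _))//.
  by rewrite dual_eval_le// w1.
(* Each inequality bounds a pair by [pair_upper], transfers it along [Phi] or [Psi], and reads off
   the coefficient by [pair_lower]. *)
exists g => a; apply/eqP; rewrite eq_le; apply/andP; split.
- apply/ler_addgt0Pr => e e0; have [s s0 ub] := pair_upper a gs e0.
  have M0 : 0 < 1 + s * (`|g a| + e) `^ p.
    by rewrite ltr_pwDl// mulr_ge0 ?powR_ge0// ltW.
  have := pair_transfer PhiC PhiZ s0 M0 ub; rewrite PsiK => h.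
  rewrite -fE; apply: pair_lower fs s0 _ h.
  by rewrite addr_ge0// ltW.
- apply/ler_addgt0Pr => e e0; have [s s0 ub] := pair_upper (Phi a) fs e0.
  rewrite fE in ub.
  have M0 : 0 < 1 + s * (`|Phi a x| + e) `^ p.
    by rewrite ltr_pwDl// mulr_ge0 ?powR_ge0// ltW.
  have := pair_transfer PsiC PsiZ s0 M0 ub; rewrite PhiK => h.
  by apply: pair_lower gs s0 _ h; rewrite addr_ge0// ltW.
Qed.

End Pairs.

(** * Functions with linear absolute value *)

(** If the sign changed between two points of the half space g > 0, then h would vanish on the
    segment joining them, where |h| = g > 0. *)
Lemma abs_linear_sign_pos (R : realType) (V : normedModType R) (h g : V -> R) :
  linear g -> continuous h -> (forall a, `|h a| = `|g a|) ->
  (forall a, 0 < g a -> h a = g a) \/ (forall a, 0 < g a -> h a = - g a).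
Proof.
move=> lg ch hg; have [g0 gD gB gZ] := linear_fctP lg.
apply: contrapT => /not_orP[/existsNP[a na] /existsNP[b nb]].
have sgn c : h c = g c \/ h c = - g c.
  by have := hg c; case: (ger0P (h c)); case: (ger0P (g c)) => ? ? ?;
    [left|right|right|left]; lra.
have {na} [ga ha] : 0 < g a /\ h a = - g a.
  by case: (sgn a) => e; split=> //; apply: contrapT => f; apply: na.
have {nb} [gb hb] : 0 < g b /\ h b = g b.
  by case: (sgn b) => e; split=> //; apply: contrapT => f; apply: nb.
pose k s := h (s *: (b - a) + a).
have ck : continuous k.
  move=> s; apply: (@continuous_comp _ _ _ (fun s : R => s *: (b - a) + a) h).
    by apply: cvgD; [apply: cvgZr_tmp; exact: cvg_id|exact: cvg_cst].
  exact: ch.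
have k0 : k 0 = - g a by rewrite /k scale0r add0r.
have k1 : k 1 = g b by rewrite /k scale1r subrK.
have [||s] := @IVT R k 0 1 0 ler01.
- exact: continuous_subspaceT.
- by rewrite k0 k1 ge_min le_max oppr_le0 (ltW ga) (ltW gb) orbT.
rewrite in_itv/= => /andP[s0 s1] ks.
have := hg (s *: (b - a) + a); rewrite -/(k s) ks normr0 gD gZ gB => /esym/eqP.
by rewrite normr_eq0 => /eqP ?; nra.
Qed.

(* Continuity forces a constant sign of h / g on each half space. *)
Lemma abs_linear_sign (R : realType) (V : normedModType R) (h g : V -> R) :
  linear g -> continuous h -> (forall a, `|h a| = `|g a|) ->
  [\/ linear h, forall a, 0 <= h a | forall a, h a <= 0].
Proof.
move=> lg ch hg.
have ln : linear (fun a => - g a).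
  by move=> k a b; rewrite lg opprD -[_ *: _]/(k * _) -[RHS]/(k * _ + _) mulrN.
have hn a : `|h a| = `|- g a| by rewrite normrN.
have h0 a : g a = 0 -> h a = 0.
  by move=> ga; apply/eqP; rewrite -normr_eq0 hg ga normr0.
(* The four sign patterns give h = |g|, g, - g and - |g| in turn. *)
have [P|P] := abs_linear_sign_pos lg ch hg;
  have [N|N] := abs_linear_sign_pos ln ch hn.
- apply: Or32 => a; have [ga|ga|ga] := ltgtP (g a) 0.
  + by rewrite N ?oppr_gt0// oppr_ge0 ltW.
  + by rewrite P// ltW.
  + by rewrite h0.
- apply: Or31; suff -> : h = g by [].
  apply/funext => a; have [ga|ga|ga] := ltgtP (g a) 0.
  + by rewrite N ?oppr_gt0// opprK.
  + by rewrite P.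
  + by rewrite h0.
- apply: Or31; suff -> : h = (fun a => - g a) by [].
  apply/funext => a; have [ga|ga|ga] := ltgtP (g a) 0.
  + by rewrite N ?oppr_gt0.
  + by rewrite P.
  + by rewrite h0// ga oppr0.
- apply: Or33 => a; have [ga|ga|ga] := ltgtP (g a) 0.
  + by rewrite N ?oppr_gt0// opprK ltW.
  + by rewrite P// oppr_le0 ltW.
  + by rewrite h0.
Qed.

(** * Linear elements of FBL^(p)[F] *)

Lemma eps_delta_continuous (R : realType) (V : normedModType R) (h : V -> R) :
  (forall v e, 0 < e ->
     exists2 d, 0 < d & forall u, `|v - u| < d -> `|h v - h u| < e) ->
  continuous h.
Proof.
move=> hP v; apply/cvgrPdist_lt => e /(hP v)[d d0 dP].
by apply/nbhs_ballP; exists d => // u; rewrite -ball_normE => /dP.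
Qed.

Section FblFunctions.
Context {R : realType} {p : R} (p1 : 1 <= p).
Implicit Types E F : normedModType R.

Lemma lattice_span_lipschitz E (g : fbl p1 E) : lattice_span g ->
  exists2 L : R, 0 <= L & forall u v : dual E, `|g u - g v| <= L * `|u - v|.
Proof.
elim=> {g} [x|k f1 g1 _ [L L0 fL] _ [M M0 gM]
    |f1 g1 _ [L L0 fL] _ [M M0 gM]|f1 g1 _ [L L0 fL] _ [M M0 gM]].
- exists `|x| => // u v; rewrite mulrC; exact: (dual_norm_bound (u - v) x).
- exists (`|k| * L + M) => [|u v]; first by rewrite addr_ge0 ?mulr_ge0.
  rewrite !fbl_linE mulrDl -mulrA.
  have -> : k * f1 u + g1 u - (k * f1 v + g1 v) =
    k * (f1 u - f1 v) + (g1 u - g1 v) by ring.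
  rewrite (le_trans (ler_normD _ _))// lerD// normrM.
  by rewrite ler_wpM2l.
- exists (L + M) => [|u v]; first exact: addr_ge0.
  rewrite mulrDl (le_trans _ (lerD (fL u v) (gM u v)))//.
  by rewrite !fbl_joinE -!joinEtotal; exact: ler_dist_join.
- exists (L + M) => [|u v]; first exact: addr_ge0.
  rewrite mulrDl (le_trans _ (lerD (fL u v) (gM u v)))//.
  by rewrite !fbl_meetE -!meetEtotal; exact: ler_dist_meet.
Qed.

(** On bounded sets f is a uniform limit of Lipschitz functions from the lattice span. *)
Lemma fbl_continuous E (f : fbl p1 E) : continuous (f : dual E -> R).
Proof.
apply: eps_delta_continuous => v e e0.
(* The factor 2 |v| + 1 bounds |v| + |u| when |v - u| < 1, so the two approximation errors together
   are at most e / 3. *)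
have v0 : 0 < 3 * (2 * `|v| + 1) by have := normr_ge0 v; lra.
have [g gS fg] := fbl_dense f (divr_gt0 e0 v0).
have [L L0 gL] := lattice_span_lipschitz gS.
have L1 : 0 < 3 * (L + 1) by lra.
pose d := Num.min 1 (e / (3 * (L + 1))).
have d0 : 0 < d by rewrite lt_min ltr01 divr_gt0.
exists d => // u vu.
have uv1 : `|v - u| < 1 by rewrite (lt_le_trans vu)// ge_min lexx.
have uvL : `|v - u| < e / (3 * (L + 1)).
  by rewrite (lt_le_trans vu)// ge_min lexx orbT.
have fgu w : `|f w - g w| <= `|f - g| * `|w|.
  by rewrite -fblB; exact: fbl_eval_le.
have nu : `|u| <= `|v| + 1.
  have := lerB_dist u v; rewrite distrC; lra.
have t1 := fgu v; have t2 := fgu u; have t3 := gL v u.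
have fgv : `|f - g| * (2 * `|v| + 1) <= e / 3.
  rewrite ltr_pdivlMr// in fg; lra.
have Lvu : L * `|v - u| <= e / 3 - `|v - u|.
  rewrite ltr_pdivlMr// in uvL; lra.
have t2' : `|f - g| * `|u| <= `|f - g| * (`|v| + 1) by exact: ler_wpM2l.
have -> : f v - f u = (f v - g v) + (g v - g u) - (f u - g u) by ring.
rewrite (le_lt_trans (ler_normB _ _))//.
rewrite (le_lt_trans (lerD (ler_normD _ _) (lexx _)))//.
have := normr_ge0 (v - u); lra.
Qed.

(** A lattice-linear expression involves finitely many evaluations and vanishes when they all do. *)
Lemma lattice_span_kernel E (f : fbl p1 E) : lattice_span f ->
  exists ys : seq E, forall a : dual E, {in ys, forall y, a y = 0} -> f a = 0.
Proof.
have cat_in (ys zs : seq E) (a : dual E) : {in ys ++ zs, forall y, a y = 0} ->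
    {in ys, forall y, a y = 0} /\ {in zs, forall y, a y = 0}.
  by move=> h; split=> y yys; apply: h; rewrite mem_cat yys ?orbT.
elim=> {f} [x|k f g _ [ys ysP] _ [zs zsP]|f g _ [ys ysP] _ [zs zsP]
    |f g _ [ys ysP] _ [zs zsP]].
- by exists [:: x] => a /(_ x); rewrite mem_head; exact.
- exists (ys ++ zs) => a /cat_in[/ysP fa /zsP ga].
  by rewrite fbl_linE fa ga mulr0 addr0.
- exists (ys ++ zs) => a /cat_in[/ysP fa /zsP ga].
  by rewrite fbl_joinE fa ga maxxx.
- exists (ys ++ zs) => a /cat_in[/ysP fa /zsP ga].
  by rewrite fbl_meetE fa ga minxx.
Qed.

End FblFunctions.

(* Each step is a one-dimensional Hahn-Banach extension: t is chosen between
   h a - e |a| and h a + e |a| on the slice a y = 1. *)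
Lemma kernel_approx (R : realType) (F : normedModType R) (ys : seq F)
    (h : dual F -> R) (e : R) : linear h -> 0 <= e ->
  (forall a : dual F, {in ys, forall y, a y = 0} -> `|h a| <= e * `|a|) ->
  exists y, forall a : dual F, `|h a - a y| <= e * `|a|.
Proof.
elim: ys h => [|z ys IH] h lh e0 hys.
  by exists 0 => a; rewrite linear0 subr0; apply: hys => y; rewrite in_nil.
have [h0 hD hB hZ] := linear_fctP lh.
pose N (a : dual F) := {in ys, forall y, a y = 0}.
have [t tP] : exists t, forall a, N a -> `|h a - t * a z| <= e * `|a|.
  have hNz a : N a -> a z = 0 -> `|h a| <= e * `|a|.
    by move=> Na az; apply: hys => y; rewrite in_cons => /predU1P[->|/Na].
  (* When all of [N] vanishes at z, the slice is empty and t = 0 serves. *)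
  have [[a0 [Na0 a0z]]|none] := pselect (exists a, N a /\ a z = 1); last first.
    exists 0 => a Na; rewrite mul0r subr0; apply: hNz => //.
    apply/eqP; apply: contrapT => /negP az; apply: none; exists ((a z)^-1 *: a).
    by split=> [y /Na ay|]; rewrite dualZ ?ay ?mulr0// mulVf.
  pose S := [set h a - e * `|a| | a in [set a | N a /\ a z = 1]].
  (* The difference a - b vanishes at z, so |h a - h b| <= e |a - b|. *)
  have Sub b : N b -> b z = 1 -> ubound S (h b + e * `|b|).
    move=> Nb bz _ [a [Na az] <-].
    have Nab : N (a - b) by move=> y yys; rewrite dualB Na// Nb// subrr.
    have := hNz _ Nab; rewrite hB dualB az bz subrr => /(_ erefl) hab.
    have nab := ler_wpM2l e0 (ler_normB a b).
    by have := ler_norm (h a - h b); lra.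
  have supS : has_sup S.
    split; first by exists (h a0 - e * `|a0|), a0.
    by exists (h a0 + e * `|a0|); exact: Sub.
  exists (sup S) => a Na; have [az|az] := eqVneq (a z) 0.
    by rewrite az mulr0 subr0 hNz.
  pose b := (a z)^-1 *: a.
  have bz : b z = 1 by rewrite dualZ mulVf.
  have Nb : N b by move=> y /Na ay; rewrite dualZ ay mulr0.
  have aE : a = a z *: b by rewrite scalerA mulfV// scale1r.
  have hbt : `|h b - sup S| <= e * `|b|.
    have l : h b - e * `|b| <= sup S.
      by apply: ub_le_sup; [exact: supS.2|exists b].
    have u : sup S <= h b + e * `|b| by apply: ge_sup; [exact: supS.1|exact: Sub].
    by rewrite ler_norml; apply/andP; split; lra.
  rewrite aE hZ normrZ dualZ bz mulr1 [sup S * _]mulrC -mulrBr normrM mulrCA.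
  by rewrite ler_wpM2l.
have [|||y yP] := IH (fun a => h a - t * a z).
- move=> k a b; rewrite lh dualD dualZ -[_ *: h a]/(k * h a).
  by rewrite -[_ *: (_ - _)]/(k * _); ring.
- by [].
- exact: tP.
exists (y + t *: z) => a.
have -> : a (y + t *: z) = a y + t * a z by rewrite linearD linearZ.
by rewrite opprD addrA addrAC.
Qed.

(** A rate with arbitrarily small values makes s Cauchy, and each bound passes to the limit in m. *)
Lemma rate_cauchy_cvg (R : realType) (V : completeNormedModType R)
    (s : nat -> V) (b : nat -> R) :
  (forall e, 0 < e -> exists n, b n < e) ->
  (forall n m, (n <= m)%N -> `|s m - s n| <= b n) ->
  exists l, forall n, `|l - s n| <= b n.
Proof.
move=> b0 sb.
have /cauchy_cvg sl : cauchy (s n @[n --> \oo]).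
  apply: cauchy_exP => e e0; have [n bn] := b0 e e0; exists (s n).
  exists n => // m /= nm; rewrite -ball_normE /= distrC.
  exact: le_lt_trans (sb n m nm) bn.
exists (lim (s n @[n --> \oo])) => n.
apply: (@closed_cvg _ _ \oo _ (fun m => `|s m - s n|) (fun r => r <= b n)).
- exact: closed_le.
- by exists n => // m /= nm; exact: sb.
- by apply: cvg_norm; apply: cvgB; [exact: sl|exact: cvg_cst].
Qed.

Lemma fbl_linear_phi (R : realType) (p : R) (p1 : 1 <= p)
    (F : completeNormedModType R) (f : fbl p1 F) :
  linear (f : dual F -> R) -> exists y, f = phi p1 y.
Proof.
move=> lf.
have approx (e : R) : 0 < e ->
    {y : F | forall a : dual F, `|f a - a y| <= e * `|a|}.
  move=> e0; apply: cid; have [g gS fg] := fbl_dense f e0.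
  have [ys ysP] := lattice_span_kernel gS.
  apply: (@kernel_approx _ _ ys) => // [|a /ysP ga]; first exact: ltW.
  have := fbl_eval_le (f - g) a; rewrite fblB ga subr0 => h.
  by rewrite (le_trans h)// ler_wpM2r// ltW.
(* The half makes e n + e m at most 1 / (n + 1) for n <= m. *)
pose e n : R := n.+1%:R^-1 / 2.
have e0 n : 0 < e n by rewrite divr_gt0 ?invr_gt0.
pose s n := sval (approx _ (e0 n)).
have sP n a : `|f a - a (s n)| <= e n * `|a| := svalP (approx _ (e0 n)) a.
have [||y yP] := @rate_cauchy_cvg R F s (fun n => n.+1%:R^-1).
- move=> k k0; exists (Num.truncn k^-1).
  by rewrite invf_plt ?posrE// truncnS_gt.
- move=> n m nm; have [a a1 <-] := norming_functional (s m - s n).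
  rewrite linearB/=.
  have := sP n a; have := sP m a.
  have em : e m <= e n by rewrite ler_pM2r ?invr_gt0// lef_pV2 ?posrE// ler_nat.
  have := e0 m; have := e0 n.
  have en : n.+1%:R^-1 = 2 * e n by rewrite /e mulrCA mulfV ?mulr1.
  have an := ler_wpM2l (ltW (e0 n)) a1; have am := ler_wpM2l (ltW (e0 m)) a1.
  by rewrite en !ler_norml => ? ? /andP[? ?] /andP[? ?]; lra.
have e_small (k : R) : 0 < k -> exists n, e n < k.
  move=> k0; exists (Num.truncn k^-1).
  apply: (@lt_trans _ _ (Num.truncn k^-1).+1%:R^-1).
    by rewrite ltr_pdivrMr// ltr_pMr ?invr_gt0// ltr1n.
  by rewrite invf_plt ?posrE// truncnS_gt.
exists y; apply: fbl_ext => a; rewrite phiE; apply/eqP.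
rewrite -subr_eq0 -normr_le0.
apply/ler_addgt0Pr => k k0; rewrite add0r.
have a1 : 0 < 3 * (`|a| + 1) by have := normr_ge0 a; lra.
have [n] := e_small _ (divr_gt0 k0 a1); rewrite ltr_pdivlMr// => nk.
have := sP n a; have := dual_norm_bound a (y - s n); rewrite linearB/=.
have := ler_wpM2l (normr_ge0 a) (yP n); rewrite -[dual_norm a]/`|a|.
have -> : n.+1%:R^-1 = 2 * e n by rewrite /e mulrCA mulfV ?mulr1.
have := e0 n; have := ler_normD (f a - a (s n)) (a (s n) - a y).
rewrite addrA subrK (distrC (a (s n))); move: (`|y - s n|) => t.
by move=> ? ? ? ? ?; lra.
Qed.

(** * Completeness and lattice homomorphisms *)

Section Complete.
Context {R : realType} {p : R} (p1 : 1 <= p) {E : normedModType R}.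

Let p0 : 0 < p. Proof. exact: lt_le_trans p1. Qed.

Lemma rate_eq0 (x C : R) (b : nat -> R) :
  (forall e, 0 < e -> exists n, b n < e) -> 0 <= C ->
  (forall n, `|x| <= b n * C) -> x = 0.
Proof.
move=> b0 C0 xb; apply/eqP; rewrite -normr_le0; apply/ler_addgt0Pr => e e0.
have C1 : 0 < C + 1 by lra.
have [n bn] := b0 _ (divr_gt0 e0 C1); rewrite ltr_pdivlMr// in bn.
have := xb n; have := normr_ge0 x; move=> ? ?.
have [bn0|bn0] := leP (b n) 0; first by nra.
by lra.
Qed.

(** Completeness with a rate. The pointwise limit g satisfies |g - s n| <= b n on every contractive
    tuple, hence in norm, and so lies in the closure. *)
Lemma fbl_rate_cauchy_cvg (s : nat -> fbl p1 E) (b : nat -> R) :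
  (forall e, 0 < e -> exists n, b n < e) ->
  (forall n m, (n <= m)%N -> `|s m - s n| <= b n) ->
  exists g : fbl p1 E, forall n u, `|g u - s n u| <= b n * `|u|.
Proof.
move=> b0 sb.
have gP (u : dual E) : {l : R | forall n, `|l - s n u| <= b n * `|u|}.
  apply: cid; apply: rate_cauchy_cvg => [e e0|n m nm].
    have u1 : 0 < `|u| + 1 by rewrite ltr_wpDl.
    have [n bn] := b0 _ (divr_gt0 e0 u1); exists n.
    rewrite ltr_pdivlMr// in bn; have := sb n n (leqnn n).
    by rewrite subrr normr0 => ?; lra.
  rewrite -[X in `|X|]/((s m - s n) u) (le_trans (fbl_eval_le _ _))//.
  by rewrite ler_wpM2r// sb.
pose g u := sval (gP u).
have gs n u : `|g u - s n u| <= b n * `|u| := svalP (gP u) n.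
have bn0 n : 0 <= b n by have := sb n n (leqnn n); rewrite subrr normr0.
have tuple_le n k (us : 'I_k -> dual E) : weakly_p_contractive p us ->
    lp_sum p ((fun u => g u - s n u) \o us) <= b n.
  move=> us1; apply/ler_addgt0Pr => e e0.
  (* For a fixed tuple, a late index m makes the contribution of g - s m at most e, while s m - s n
     contributes at most b n. *)
  set C := lp_sum p (fun i => `|us i|).
  have C0 : 0 <= C by exact: lp_sum_ge0.
  have C1 : 0 < 2 * (C + 1) by lra.
  have [q bq] := b0 _ (divr_gt0 e0 C1); rewrite ltr_pdivlMr// in bq.
  pose m := maxn n q.
  (* As b need not decrease, the estimate passes through s q, which costs the factor 2. *)
  have gm u : `|g u - s m u| <= 2 * b q * `|u|.
    have -> : g u - s m u = (g u - s q u) - (s m u - s q u) by ring.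
    rewrite (le_trans (ler_normB _ _))//.
    have : `|s m u - s q u| <= b q * `|u|.
      rewrite -fblB (le_trans (fbl_eval_le _ _))// ler_wpM2r//.
      by apply: sb; rewrite leq_maxr.
    by have := gs q u; lra.
  have -> : (fun u => g u - s n u) \o us =
      (fun i => (g (us i) - s m (us i)) + (s m - s n) (us i)).
    by apply/funext => i; rewrite fblB /=; ring.
  rewrite (le_trans (lp_sumD p1 _ _))// addrC lerD//.
    by rewrite (le_trans (fbl_tuple_le _ us1))// sb// leq_maxl.
  apply: (@le_trans _ _ (lp_sum p (fun i => 2 * b q * `|us i|))).
    apply: (lp_sum_mono p1) => i; rewrite [leRHS]ger0_norm//.
    by rewrite mulr_ge0// mulr_ge0.
  rewrite (lp_sumZ p1) ger0_norm ?mulr_ge0//.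
  by have := bn0 q; move: (b q) bq => t; rewrite -/C; nra.
have ghom : pos_homogeneous g.
  move=> a u a0; apply/eqP; rewrite -subr_eq0; apply/eqP.
  apply: (rate_eq0 b0 (C := 2 * a * `|u|)); first by rewrite mulr_ge0// mulr_ge0.
  move=> n; have := gs n (a *: u); have := ler_wpM2l a0 (gs n u).
  rewrite fbl_hom// normrZ (ger0_norm a0) -{1}(ger0_norm a0) -normrM.
  have -> : g (a *: u) - a * g u =
    (g (a *: u) - a * s n u) - a * (g u - s n u) by ring.
  by have := ler_normB (g (a *: u) - a * s n u) (a * (g u - s n u)); lra.
have dfin n : (fun u => g u - s n u) \in @finite_fbl_norm R p E.
  apply/finite_fbl_normP; split.
    by move=> a u a0; rewrite ghom// fbl_hom// mulrBr.
  exact: (fine_fbl_norm_lub p1 (tuple_le n)).1.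
have gfin : g \in @finite_fbl_norm R p E.
  apply/finite_fbl_normP; split; first exact: ghom.
  have /finite_fbl_normP[_ dy] := dfin 0%N.
  have /finite_fbl_normP[_ sy] := homfun_valP (s 0%N).
  have [+ _] := fine_fbl_normD p1 dy sy.
  suff -> : (fun u => g u - s 0%N u) + s 0%N = g by [].
  by apply/funext => u; exact: subrK.
have gfbl : HomFun gfin \in fbl_pred p1 (E:=E).
  apply/fbl_predP => e e0; have e20 : 0 < e / 2 by rewrite divr_gt0.
  have [n bn] := b0 _ e20.
  have [h Sh sh] := elimT (fbl_predP p1 (fbl_val (s n))) (fbl_valP (s n)) _ e20.
  exists h; first exact: Sh.
  rewrite [e]splitr; apply: le_lt_trans (ltrD (le_lt_trans _ bn) sh); last first.
    exact: (fine_fbl_norm_lub p1 (tuple_le n)).2.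
  apply: (@homfun_norm_dom _ _ p1 _ _ (HomFun (dfin n)) (fbl_val (s n) - h)) => u.
  rewrite -[(HomFun gfin - h) u]/(g u - h u) -[(_ - h) u]/(s n u - h u).
  rewrite -[HomFun (dfin n) u]/(g u - s n u).
  by rewrite (le_trans _ (ler_normD _ _))// addrA subrK.
by exists (Fbl gfbl).
Qed.

End Complete.

Section LatticeHom.
Context {R : realType} {p : R} (p1 : 1 <= p).
Implicit Types E F : normedModType R.

Lemma lattice_hom_mono E F (S : fbl p1 E -> fbl p1 F) (f g : fbl p1 E) u :
  lattice_homomorphism S -> (forall v, f v <= g v) -> S f u <= S g u.
Proof.
move=> [_ _ SU] fg; have -> : g = (f `|` g)%O.
  by apply: fbl_ext => v; rewrite fbl_joinE max_r.
by rewrite SU fbl_joinE le_max lexx.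
Qed.

Lemma geometric_small (e : R) : 0 < e -> exists n, 2^-1 ^+ n < e.
Proof.
move=> e0; have [n _ nP] : \forall n \near \oo, `|0 - 2^-1 ^+ n| < e.
  apply: cvgr_dist_lt => //; apply: cvg_expr.
  by rewrite ger0_norm ?invr_ge0// invf_lt1// ltr1n.
exists n; have := nP n (leqnn n).
by rewrite sub0r normrN ger0_norm// exprn_ge0// invr_ge0.
Qed.

Lemma geometric_partial (E : normedModType R) (h : nat -> fbl p1 E) :
  (forall n, `|h n| <= 2^-1 ^+ n.+1) ->
  forall n m, (n <= m)%N ->
  `|\sum_(k < m) h k - \sum_(k < n) h k| <= 2^-1 ^+ n.
Proof.
move=> hn n m /subnK <-; rewrite addnC; move: (m - n)%N => d.
suff : `|\sum_(k < n + d) h k - \sum_(k < n) h k| <= 2^-1 ^+ n - 2^-1 ^+ (n + d).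
  by move=> /le_trans; apply; rewrite lerBlDr lerDl exprn_ge0// invr_ge0.
elim: d => [|d IH]; first by rewrite addn0 !subrr normr0.
rewrite addnS big_ord_recr/= addrAC (le_trans (ler_normD _ _))//.
have := hn (n + d)%N; rewrite exprS => ?.
by move: IH; move: (`|_ - _|) => t ?; lra.
Qed.

Lemma fbl_sumE E (h : nat -> fbl p1 E) n u :
  (\sum_(k < n) h k) u = \sum_(k < n) h k u.
Proof. by elim/big_rec2: _ => // k x f _ <-. Qed.

(* g is the sum of n |f - s n| for a sequence s converging fast to f. *)
Lemma relatively_uniform_dense E (f : fbl p1 E) :
  exists (s : nat -> fbl p1 E) (g : fbl p1 E), forall n,
    lattice_span (s n) /\ forall u, `|f u - s n u| <= n.+1%:R^-1 * g u.
Proof.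
have rate_gt0 n : 0 < n.+1%:R^-1 * 2^-1 ^+ n.+1 :> R.
  by rewrite mulr_gt0 ?invr_gt0// exprn_gt0// invr_gt0.
pose s n := sval (cid2 (fbl_dense f (rate_gt0 n))).
have [sS sf] : (forall n, lattice_span (s n)) /\
    (forall n, `|f - s n| < n.+1%:R^-1 * 2^-1 ^+ n.+1).
  by split=> n; rewrite /s; case: cid2.
(* The join is the absolute value of f - s n; the rate chosen for s makes the norms of h
   summable. *)
pose h n := n.+1%:R *: ((f - s n) `|` (s n - f))%O.
have hE n u : h n u = n.+1%:R * `|f u - s n u|.
  rewrite -[LHS]/(n.+1%:R * ((f - s n) `|` (s n - f))%O u) fbl_joinE !fblB.
  rewrite -(opprB (f u)); congr (_ * _).
  by case: ger0P => ?; [rewrite max_l|rewrite max_r]; lra.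
have hn n : `|h n| <= 2^-1 ^+ n.+1.
  apply: (@le_trans _ _ `|n.+1%:R *: (f - s n)|).
    apply: (homfun_norm_mono p1) => u; rewrite -[X in `|X| <= _]/(h n u) hE.
    by rewrite -[X in _ <= `|X|]/(n.+1%:R * (f u - s n u)) !normrM normr_id.
  by rewrite normrZ normr_nat -ler_pdivlMl// ltW.
have [g gP] := fbl_rate_cauchy_cvg geometric_small (geometric_partial hn).
exists s, g => n; split=> [|u]; first exact: sS.
rewrite ler_pdivlMl// -hE; apply/ler_addgt0Pr => e e0.
have u1 : 0 < `|u| + 1 by rewrite ltr_wpDl.
have [m] := geometric_small (divr_gt0 e0 u1); rewrite ltr_pdivlMr// => me.
have := gP (n.+1 + m)%N u; rewrite fbl_sumE ler_distl => /andP[gu _].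
(* All terms are nonnegative, so h n u is below a partial sum, and these converge to g u. *)
have hu : h n u <= \sum_(k < n.+1 + m) h k u.
  have k0 : (n < n.+1 + m)%N by rewrite addSn ltnS leq_addr.
  rewrite (bigD1 (Ordinal k0))//= lerDl sumr_ge0// => k _.
  by rewrite -[X in 0 <= X]/(h k u) hE mulr_ge0.
have ab : 2^-1 ^+ (n.+1 + m) <= 2^-1 ^+ m :> R.
  by rewrite exprD ler_piMl// ?exprn_ge0 ?exprn_ile1 ?invr_ge0// invf_le1// ler1n.
have b0 : 0 <= 2^-1 ^+ m :> R by rewrite exprn_ge0 ?invr_ge0.
have abu := ler_wpM2r (normr_ge0 u) ab.
move: abu b0 gu hu me; move: (2^-1 ^+ m) (_ ^+ (n.+1 + m)) => b a.
move: (h n u) (g u) (\sum_(k < _) _) => x y z.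
by move=> *; lra.
Qed.

(** Being linear and monotone, S preserves the order bounds f <= c g + h and h <= c g + f. *)
Lemma lattice_hom_dist E F (S : fbl p1 E -> fbl p1 F) (f h g : fbl p1 E) c u :
  lattice_homomorphism S -> (forall v, `|f v - h v| <= c * g v) ->
  `|S f u - S h u| <= c * S g u.
Proof.
move=> hS fh; have [lS _ _] := hS.
have fle v : f v <= (c *: g + h) v.
  by rewrite fbl_linE -lerBlDr (le_trans (ler_norm _)).
have hle v : h v <= (c *: g + f) v.
  by rewrite fbl_linE -lerBlDr (le_trans (ler_norm _))// distrC.
have := lattice_hom_mono u hS fle; have := lattice_hom_mono u hS hle.
by rewrite !lS !fbl_linE ler_norml => ? ?; apply/andP; split; lra.
Qed.

Lemma lattice_hom_eq E F (S1 S2 : fbl p1 E -> fbl p1 F) :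
  lattice_homomorphism S1 -> lattice_homomorphism S2 ->
  (forall x, S1 (phi p1 x) = S2 (phi p1 x)) -> S1 = S2.
Proof.
move=> h1 h2 S12.
have span f : lattice_span f -> S1 f = S2 f.
  have [l1 I1 U1] := h1; have [l2 I2 U2] := h2.
  elim=> {f} [x|a f g _ fE _ gE|f g _ fE _ gE|f g _ fE _ gE]; first exact: S12.
  - by rewrite l1 l2 fE gE.
  - by rewrite U1 U2 fE gE.
  - by rewrite I1 I2 fE gE.
apply/funext => f; have [s [g sg]] := relatively_uniform_dense f.
apply: fbl_ext => u; apply/eqP; rewrite -subr_eq0; apply/eqP.
have dle n : `|S1 f u - S2 f u| <= n.+1%:R^-1 * (S1 g u + S2 g u).
  have -> : S1 f u - S2 f u = (S1 f u - S1 (s n) u) - (S2 f u - S2 (s n) u).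
    by rewrite (span _ (sg n).1); ring.
  rewrite (le_trans (ler_normB _ _))// mulrDr.
  by rewrite lerD// lattice_hom_dist//; exact: (sg n).2.
apply: (rate_eq0 _ _ dle) => [e e0|]; last first.
  by have := le_trans (normr_ge0 _) (dle 0%N); rewrite invr1 mul1r.
by exists (Num.truncn e^-1); rewrite invf_plt ?posrE// truncnS_gt.
Qed.

Lemma fbl_norm_comp E F (A : dual F -> dual E) (f : fbl p1 E) (g : fbl p1 F) :
  preserves_contractive p A -> (forall u, g u = f (A u)) -> `|g| <= `|f|.
Proof.
move=> Ac gf; apply: fbl_norm_lub => n us us1.
have -> : g \o us = f \o (A \o us) by apply/funext => k; exact: gf.
exact: fbl_tuple_le (Ac _ _ us1).
Qed.

(** [A] is the adjoint of [U]. That f o A belongs to the free lattice over F is clear on the lattice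
    span; for s n in the span tending to f, the s n o A are Cauchy, since composition with A does
    not increase norms, and tend to f o A. *)
Lemma exists_composition E F (U : E -> F) :
  linear U -> (forall x, `|U x| <= `|x|) ->
  exists (A : dual F -> dual E) (S : fbl p1 E -> fbl p1 F),
    [/\ forall u x, A u x = u (U x), preserves_contractive p A
      & forall f u, S f u = f (A u)].
Proof.
move=> lU Un.
have lA (u : dual F) : linear (fun x => u (U x)).
  by move=> a x y; rewrite lU linearP.
have bA (u : dual F) x : `|u (U x)| <= `|u| * `|x|.
  by rewrite (le_trans (dual_norm_bound u _))// ler_wpM2l// dual_norm_ge0.
pose A u : dual E := Dual (bounded_dual (lA u) (bA u)).
have Ac : preserves_contractive p A.
  move=> n us /(weakly_p_contractiveP p1) us1; apply/(weakly_p_contractiveP p1).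
  by move=> x x1; apply: us1; rewrite (le_trans (Un x)).
have span (f : fbl p1 E) :
    lattice_span f -> exists g : fbl p1 F, forall u, g u = f (A u).
  elim=> {f} [x|a f1 f2 _ [g1 e1] _ [g2 e2]|f1 f2 _ [g1 e1] _ [g2 e2]
      |f1 f2 _ [g1 e1] _ [g2 e2]].
  - by exists (phi p1 (U x)).
  - by exists (a *: g1 + g2) => u; rewrite !fbl_linE e1 e2.
  - by exists (g1 `|` g2)%O => u; rewrite !fbl_joinE e1 e2.
  - by exists (g1 `&` g2)%O => u; rewrite !fbl_meetE e1 e2.
have comp (f : fbl p1 E) : {g : fbl p1 F | forall u, g u = f (A u)}.
  apply: cid.
  have rate_gt0 n : 0 < 2^-1 ^+ n.+1 :> R by rewrite exprn_gt0// invr_gt0.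
  pose s n := sval (cid2 (fbl_dense f (rate_gt0 n))).
  have [sS sf] : (forall n, lattice_span (s n)) /\
      (forall n, `|f - s n| < 2^-1 ^+ n.+1).
    by split=> n; rewrite /s; case: cid2.
  pose t n := sval (cid (span _ (sS n))).
  have tE n u : t n u = s n (A u) := svalP (cid (span _ (sS n))) u.
  have tn n m : (n <= m)%N -> `|t m - t n| <= 2^-1 ^+ n.
    move=> nm; apply: (@le_trans _ _ `|s m - s n|).
      by apply: fbl_norm_comp Ac _ => u; rewrite !fblB !tE.
    have -> : s m - s n = (f - s n) - (f - s m).
      by rewrite [RHS]addrC opprB addrA subrK.
    rewrite (le_trans (ler_normB _ _))//.
    rewrite (le_trans (lerD (ltW (sf n)) (ltW (sf m))))//.
    rewrite !exprS.
    have : 2^-1 ^+ m <= 2^-1 ^+ n :> R.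
      by rewrite ler_wiXn2l ?invr_ge0// invf_le1// ler1n.
    by move: (_ ^+ n) (_ ^+ m) => a b ?; lra.
  have [g gP] := fbl_rate_cauchy_cvg geometric_small tn.
  exists g => u; apply/eqP; rewrite -subr_eq0; apply/eqP.
  apply: (rate_eq0 geometric_small (C := `|u| + `|A u|)); first exact: addr_ge0.
  move=> n; have -> : g u - f (A u) = (g u - t n u) - (f - s n) (A u).
    by rewrite tE fblB; ring.
  rewrite (le_trans (ler_normB _ _))// mulrDr lerD//.
  rewrite (le_trans (fbl_eval_le _ _))// ler_wpM2r// (le_trans (ltW (sf n)))//.
  by rewrite exprS ler_piMl// ?exprn_ge0 ?invr_ge0// invf_le1// ler1n.
exists A, (fun f => sval (comp f)); split=> // f u; exact: (svalP (comp f)).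
Qed.

End LatticeHom.

(** * Isometries *)

Lemma isometry0 (R : realType) (V W : normedModType R) (U : V -> W) :
  linear U -> is_isometry U -> forall x, `|U x| = `|x|.
Proof.
move=> lU iU x; have U0 : U 0 = 0.
  by have := lU (-1) 0 0; rewrite scaler0 addr0 scaleN1r addNr.
by have := iU x 0; rewrite U0 !subr0.
Qed.

Lemma surj_isometry_inverse (R : realType) (V W : normedModType R) (U : V -> W) :
  linear U -> is_isometry U -> set_surj setT setT U ->
  exists U' : W -> V, [/\ linear U', is_isometry U', cancel U U' & cancel U' U].
Proof.
move=> lU iU sU.
have inv y : {x | U x = y} by apply: cid; have [x _ <-] := sU y I; exists x.
pose U' y := sval (inv y); have U'K : cancel U' U := fun y => svalP (inv y).
have Ui : injective U.
  move=> x y xy; apply/eqP; rewrite -subr_eq0 -normr_eq0 -iU xy subrr normr0.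
  exact: eqxx.
exists U'; split=> [a y z|y z|x|//].
- by apply: Ui; rewrite lU !U'K.
- by rewrite -iU !U'K.
- by apply: Ui; rewrite U'K.
Qed.

Section Isometries.
Context {R : realType} {p : R} (p1 : 1 <= p).
Implicit Types E F : normedModType R.

(** Composition with the adjoints of U and of its inverse gives mutually inverse contractions. *)
Lemma isometry_extension E F (U : E -> F) :
  linear U -> is_isometry U -> set_surj setT setT U ->
  exists S : fbl p1 E -> fbl p1 F,
    [/\ lattice_isometry S, set_surj setT setT S
      & forall x, S (phi p1 x) = phi p1 (U x)].
Proof.
move=> lU iU sU; have [V [lV iV UK VK]] := surj_isometry_inverse lU iU sU.
have nU x : `|U x| <= `|x| by rewrite isometry0.
have nV y : `|V y| <= `|y| by rewrite isometry0.
have [A [S [AE Ac SE]]] := exists_composition p1 lU nU.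
have [B [S' [BE Bc SE']]] := exists_composition p1 lV nV.
have AK u : B (A u) = u by apply: dualP => y; rewrite BE AE VK.
have BK u : A (B u) = u by apply: dualP => x; rewrite AE BE UK.
have SB f g : S f - S g = S (f - g) by apply: fbl_ext => u; rewrite !(fblB, SE).
exists S; split; last by move=> x; apply: fbl_ext => u; rewrite SE !phiE AE.
  split; first split.
  - by move=> a f g; apply: fbl_ext => u; rewrite SE !fbl_linE !SE.
  - by move=> f g; apply: fbl_ext => u; rewrite SE !fbl_meetE !SE.
  - by move=> f g; apply: fbl_ext => u; rewrite SE !fbl_joinE !SE.
  - move=> f g; rewrite SB; apply/eqP; rewrite eq_le (fbl_norm_comp Ac)//=.
    by apply: fbl_norm_comp Bc _ => v; rewrite SE BK.
by move=> g _; exists (S' g) => //; apply: fbl_ext => u; rewrite SE SE' AK.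
Qed.

(** Contractive tuples are preserved because |T (phi x)| <= |x| bounds the values of T (phi x) on
    each of them. *)
Lemma exists_pullback E F (T : fbl p1 E -> fbl p1 F) :
  linear T -> (forall f, `|T f| <= `|f|) ->
  exists A : dual F -> dual E,
    [/\ forall u x, A u x = T (phi p1 x) u, preserves_contractive p A,
      forall (a : R) u, 0 <= a -> A (a *: u) = a *: A u
      & forall u, `|A u| <= `|u|].
Proof.
move=> lT nT.
have lA u : linear (fun x => T (phi p1 x) u).
  by move=> a x y; rewrite phi_linear lT fbl_linE.
have bA (u : dual F) x : `|T (phi p1 x) u| <= `|u| * `|x|.
  rewrite (le_trans (fbl_eval_le _ _))// mulrC ler_wpM2l//.
  by rewrite (le_trans (nT _))// norm_phi.
exists (fun u => Dual (bounded_dual (lA u) (bA u))); split=> //.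
- move=> n us us1; apply/(weakly_p_contractiveP p1) => x x1.
  apply: le_trans (fbl_tuple_le (T (phi p1 x)) us1) _.
  by rewrite (le_trans (nT _))// norm_phi.
- by move=> a u a0; apply: dualP => x; rewrite dualZ /= fbl_hom.
- move=> u; apply: dual_norm_lub => x x1; apply: le_trans (bA u x) _.
  by rewrite ler_piMr.
Qed.

(** Both sides agree on phi E and respect the lattice operations, so they agree on the span; both
    are bounded by |f| |u|, which extends this to limits. *)
Lemma lattice_hom_pullback E F (T : fbl p1 E -> fbl p1 F) (A : dual F -> dual E) :
  lattice_homomorphism T -> (forall f, `|T f| <= `|f|) ->
  (forall u x, A u x = T (phi p1 x) u) -> (forall u, `|A u| <= `|u|) ->
  forall f u, T f u = f (A u).
Proof.
move=> [lT IT UT] nT AE An f u.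
have span g : lattice_span g -> T g u = g (A u).
  elim=> {g} [x|a g h _ gE _ hE|g h _ gE _ hE|g h _ gE _ hE].
  - by rewrite phiE AE.
  - by rewrite lT !fbl_linE gE hE.
  - by rewrite UT !fbl_joinE gE hE.
  - by rewrite IT !fbl_meetE gE hE.
have TB g h : T (g - h) = T g - T h.
  by rewrite -scaleN1r addrC lT scaleN1r addrC.
apply/eqP; rewrite -subr_eq0 -normr_le0; apply/ler_addgt0Pr => e e0.
have u0 : 0 < 2 * (`|u| + 1) by have := normr_ge0 u; lra.
have [g gS fg] := fbl_dense f (divr_gt0 e0 u0); rewrite ltr_pdivlMr// in fg.
have -> : T f u - f (A u) = T (f - g) u - (f - g) (A u).
  by rewrite TB !fblB (span g gS); ring.
have Tfg : `|T (f - g) u| <= `|f - g| * `|u|.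
  by rewrite (le_trans (fbl_eval_le _ _))// ler_wpM2r.
have fgA : `|(f - g) (A u)| <= `|f - g| * `|u|.
  by rewrite (le_trans (fbl_eval_le _ _))// ler_wpM2l.
rewrite (le_trans (ler_normB _ _))// (le_trans (lerD Tfg fgA))// add0r.
have := normr_ge0 (f - g); move: fg; move: `|f - g| `|u| => a b ? ?; lra.
Qed.

Lemma lattice_isometry_inverse E F (T : fbl p1 E -> fbl p1 F) :
  lattice_isometry T -> set_surj setT setT T ->
  exists T' : fbl p1 F -> fbl p1 E,
    [/\ lattice_isometry T', set_surj setT setT T', cancel T T' & cancel T' T].
Proof.
move=> [[lT IT UT] iT] sT.
have [T' [lT' iT' TK T'K]] := surj_isometry_inverse lT iT sT.
exists T'; split=> //; last by move=> f _; exists (T f).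
split=> //; split=> // f g; apply: (can_inj TK).
  by rewrite IT !T'K.
by rewrite UT !T'K.
Qed.

(* If T (phi x) >= 0 then T maps phi x and its absolute value to the same
   element, so phi x >= 0, which forces x = 0 as phi x is linear. *)
Lemma lattice_hom_phi_ge0 E F (T : fbl p1 E -> fbl p1 F) (x : E) :
  lattice_homomorphism T -> injective T ->
  (forall u, 0 <= T (phi p1 x) u) -> x = 0.
Proof.
move=> [lT IT UT] Ti T0.
have phiN : phi p1 (- x) = - phi p1 x.
  by apply: fbl_ext => u; rewrite phiE linearN.
have TN : T (- phi p1 x) = - T (phi p1 x).
  have T00 : T 0 = 0 by have := lT (-1) 0 0; rewrite scaler0 addr0 scaleN1r addNr.
  by have := lT (-1) (phi p1 x) 0; rewrite T00 !scaleN1r !addr0.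
have absx : (phi p1 x `|` - phi p1 x)%O = phi p1 x.
  apply: Ti; rewrite UT TN; apply: fbl_ext => u; rewrite fbl_joinE max_l//.
  by rewrite fblN (le_trans _ (T0 u))// oppr_le0.
have ux (u : dual E) : 0 <= u x.
  have := congr1 (fun f : fbl p1 E => f u) absx; rewrite fbl_joinE.
  rewrite fblN phiE => <-.
  by rewrite le_max; case: (ger0P (u x)) => // ?; rewrite oppr_ge0 ltW ?orbT.
have [u _ ux0] := norming_functional x.
have := ux (- u); rewrite -[(- u) x]/(- u x) ux0 oppr_ge0 normr_le0.
by move=> /eqP.
Qed.

End Isometries.

(** * Surjective lattice isometries as extensions of isometries *)

Lemma lattice_isometry_phi (R : realType) (p : R) (p1 : 1 <= p)
    (E : normedModType R) (F : completeNormedModType R)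
    (T : fbl p1 E -> fbl p1 F) :
  smooth (dual E) -> smooth (dual F) ->
  lattice_isometry T -> set_surj setT setT T ->
  forall x, exists y, T (phi p1 x) = phi p1 y.
Proof.
move=> smE smF hT sT.
have [T' [hT' sT' TK T'K]] := lattice_isometry_inverse hT sT.
have [[lT _ _] iT] := hT; have [[lT' _ _] iT'] := hT'.
have nT f : `|T f| <= `|f| by rewrite isometry0.
have nT' f : `|T' f| <= `|f| by rewrite isometry0.
have [A [AE Ac AZ An]] := exists_pullback lT nT.
have [B [BE Bc BZ Bn]] := exists_pullback lT' nT'.
have TA := lattice_hom_pullback hT.1 nT AE An.
have TB := lattice_hom_pullback hT'.1 nT' BE Bn.
have AK : cancel A B by move=> u; apply: dualP => z; rewrite BE -TA T'K.
have BK : cancel B A by move=> u; apply: dualP => z; rewrite AE -TB TK.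
have phiZ (G : normedModType R) a (x : G) : phi p1 (a *: x) = a *: phi p1 x.
  by apply: fbl_ext => u; rewrite phiE linearZ.
have phi0 (G : normedModType R) : phi p1 (0 : G) = 0.
  by apply: fbl_ext => u; exact: (linear0 u).
have T0 : T 0 = 0 by have := lT (-1) 0 0; rewrite scaler0 addr0 scaleN1r addNr.
have TZ a f : T (a *: f) = a *: T f by have := lT a f 0; rewrite T0 !addr0.
have unit x : `|x| = 1 -> exists y, T (phi p1 x) = phi p1 y.
  move=> x1.
  have [g gE] := abs_linear_at_point p1 smE smF Ac Bc AZ BZ An Bn AK BK x1.
  have x0 : x <> 0.
    by move=> x0; move: x1; rewrite x0 normr0 => /eqP; rewrite eq_sym oner_eq0.
  have Tg u : `|T (phi p1 x) u| = `|g u| by rewrite -AE gE.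
  apply: fbl_linear_phi.
  have [//|h|h] := abs_linear_sign (dual_linear g)
    (@fbl_continuous _ _ p1 _ (T (phi p1 x))) Tg.
  - by case: x0; exact: lattice_hom_phi_ge0 hT.1 (can_inj TK) h.
  (* The nonpositive case is the nonnegative one for - x. *)
  - case: x0; apply/eqP; rewrite -oppr_eq0; apply/eqP.
    apply: lattice_hom_phi_ge0 hT.1 (can_inj TK) _ => u.
    by rewrite -scaleN1r phiZ TZ scaleN1r fblN oppr_ge0.
move=> x; have [->|x0] := eqVneq x 0.
  by exists 0; rewrite !phi0 T0.
have nx : `|x| != 0 by rewrite normr_eq0.
have [|y Ty] := unit (`|x|^-1 *: x).
  by rewrite normrZ normfV normr_id mulVf.
exists (`|x| *: y); rewrite phiZ -Ty phiZ TZ scalerA mulfV//.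
by rewrite scale1r.
Qed.

(** Since [S] fits the description, [get] returns a map that fits it too, and [lattice_hom_eq]
    identifies the two. *)
Lemma ubarE (R : realType) (p : R) (p1 : 1 <= p) (E F : normedModType R)
    (U : E -> F) (S : fbl p1 E -> fbl p1 F) :
  lattice_homomorphism S -> (forall x, S (phi p1 x) = phi p1 (U x)) ->
  ubar p1 U = S.
Proof.
move=> hS SU.
have [hu uU] : [set S' : fbl p1 E -> fbl p1 F | lattice_homomorphism S' /\
    forall x, S' (phi p1 x) = phi p1 (U x)] (ubar p1 U).
  by apply: getPex; exists S.
by apply: lattice_hom_eq => // x; rewrite uU SU.
Qed.

Theorem theorem10p18 (R : realType) (p : R) (p1 : 1 <= p)
    (E F : completeNormedModType R)
    (smoothE : smooth (dual E)) (smoothF : smooth (dual F)) :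
  (forall T : fbl p1 E -> fbl p1 F,
     lattice_isometry T /\ set_surj setT setT T <->
     exists U : E -> F,
       [/\ linear U, is_isometry U, set_surj setT setT U & T = ubar p1 U]) /\
  (isometric E F <-> lattice_isometric p1 E F).
Proof.
have main (T : fbl p1 E -> fbl p1 F) :
    lattice_isometry T /\ set_surj setT setT T <->
    exists U : E -> F,
      [/\ linear U, is_isometry U, set_surj setT setT U & T = ubar p1 U].
  split=> [[hT sT]|[U [lU iU sU ->]]]; last first.
    have [S [hS sS SU]] := isometry_extension p1 lU iU sU.
    by rewrite (ubarE hS.1 SU).
  have [T' [hT' sT' TK T'K]] := lattice_isometry_inverse hT sT.
  pose U x := sval (cid (lattice_isometry_phi smoothE smoothF hT sT x)).
  have UE x : T (phi p1 x) = phi p1 (U x) :=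
    svalP (cid (lattice_isometry_phi smoothE smoothF hT sT x)).
  have [[lT _ _] iT] := hT.
  have phiB (G : normedModType R) (x y : G) :
      phi p1 (x - y) = phi p1 x - phi p1 y.
    by apply: fbl_ext => u; rewrite fblB !phiE linearB.
  exists U; split.
  - by move=> a x y; apply: (phi_inj (p1 := p1)); rewrite -UE !phi_linear lT !UE.
  - move=> x y; rewrite -(norm_phi p1 (U x - U y)) -(norm_phi p1 (x - y)).
    by rewrite !phiB -!UE iT.
  (* Surjectivity comes from the inverse of T, which maps phi y to some phi x. *)
  - move=> y _; have [x xE] := lattice_isometry_phi smoothF smoothE hT' sT' y.
    by exists x => //; apply: (phi_inj (p1 := p1)); rewrite -UE -xE T'K.
  - by rewrite (ubarE hT.1 UE).
split=> //; split=> [[U [lU iU sU]]|[T /main[U [lU iU sU _]]]]; last by exists U.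
by exists (ubar p1 U); apply/main; exists U.
Qed.
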